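(* Assume that both the original solution $\mathfrak{R}(t)\in\mathcal{M}_{l,m}$ of $\dot{\mathfrak{R}}=\mathcal{L}(t,\mathfrak{R})$ and its DO approximation $R(t)\in\mathscr{M}$, solution of $$\dot R=\Pi_{\mathcal{T}(R)}(\mathcal{L}(t,R)),\qquad R(0)=\Pi_{\mathscr{M}}(\mathfrak{R}(0)),$$ are defined on a time interval $[0,T]$ and that the following conditions hold: 1. $\mathcal{L}$ is Lipschitz continuous: there exists a constant $K$ such that $\|\mathcal{L}(t,A)-\mathcal{L}(t,B)\|\le K\|A-B\|$ for all $t\in[0,T]$ and all $A,B\in\mathcal{M}_{l,m}$. 2. The original solution $\mathfrak{R}(t)$ remains close to the low rank manifold $\mathscr{M}$, in the sense that $\mathfrak{R}(t)$ does not cross the skeleton of $\mathscr{M}$ on $[0,T]$, i.e. there is no crossing of the singular value of order $r$: $\sigma_r(\mathfrak{R}(t))>\sigma_{r+1}(\mathfrak{R}(t))$ for all $t\in[0,T]$. Then the error of the DO approximation $R(t)$ remains controlled by the best approximation error $\|\mathfrak{R}(t)-\Pi_{\mathscr{M}}(\mathfrak{R}(t))\|$ on $[0,T]$: for all $t\in[0,T]$, $$\|R(t)-\Pi_{\mathscr{M}}(\mathfrak{R}(t))\|\le\int_0^t\|\mathfrak{R}(s)-\Pi_{\mathscr{M}}(\mathfrak{R}(s))\|\left(K+\frac{\|\mathcal{L}(s,\mathfrak{R}(s))\|}{\sigma_r(\mathfrak{R}(s))-\sigma_{r+1}(\mathfrak{R}(s))}\right)e^{\eta(t-s)}\,ds,$$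 where $\eta$ is the constant $$\eta=K+\sup_{t\in[0,T]}\frac{2}{\sigma_r(\mathfrak{R}(t))}\|\mathcal{L}(t,\mathfrak{R}(t))\|.$$
   Context: $\mathcal{M}_{l,m}$ is the space of $l\times m$ real matrices with the Frobenius inner product and norm $\|\cdot\|$, and $\mathcal{L}(t,\cdot)$ is a time-dependent operator acting on $\mathcal{M}_{l,m}$. $\mathscr{M}=\{R\in\mathcal{M}_{l,m} : \mathrm{rank}(R)=r\}$ is the fixed rank manifold, $\mathcal{T}(R)$ its tangent space at $R$, and $\Pi_{\mathcal{T}(R)}$ the orthogonal projection onto $\mathcal{T}(R)$. $\sigma_1(A)\ge\sigma_2(A)\ge\dots$ are the singular values of $A$ (zero beyond the rank). $\Pi_{\mathscr{M}}(A)$ is the rank $r$ truncated SVD of $A$, i.e. the unique closest point to $A$ in $\mathscr{M}$, defined when $\sigma_r(A)>\sigma_{r+1}(A)$. The skeleton of $\mathscr{M}$ is the set of points admitting more than one closest point in $\mathscr{M}$, characterized by $\sigma_r(A)=\sigma_{r+1}(A)$. *)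

(* Defs.v *)
From HB Require Import structures.
From mathcomp Require Import all_boot all_order all_algebra.
From mathcomp Require Import all_classical all_reals all_analysis.
Import Order.TTheory GRing.Theory Num.Theory.
Import numFieldNormedType.Exports.

Set Implicit Arguments.
Unset Strict Implicit.
Unset Printing Implicit Defensive.

Local Open Scope classical_set_scope.
Local Open Scope ring_scope.

(* Frobenius inner product and norm.  The MathComp-Analysis norm `|A| on
   matrices is the max norm: it is used only for its topology. *)
Definition fdot (R : realType) (l m : nat) (A B : 'M[R]_(l, m)) : R :=
  \tr (A^T *m B).

Definition fnorm (R : realType) (l m : nat) (A : 'M[R]_(l, m)) : R :=
  Num.sqrt (fdot A A).

(* The l x m "diagonal" matrix with entries s 0, ..., s k.-1, 0, 0, ... *)
Definition rect_diag (R : realType) (l m k : nat) (s : nat -> R) :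
    'M[R]_(l, m) :=
  \matrix_(i, j) (if ((i : nat) == (j : nat)) && (i < k)%N then s i else 0).

(* Full singular value decomposition A = U S V^T; s lists the singular values
   from index 0, in nonincreasing order, padded with zeros. *)
Definition is_svd (R : realType) (l m : nat) (A : 'M[R]_(l, m))
    (U : 'M[R]_l) (s : nat -> R) (V : 'M[R]_m) : Prop :=
  [/\ U^T *m U = 1%:M /\ V^T *m V = 1%:M,
      forall i, 0 <= s i,
      forall i j, (i <= j)%N -> s j <= s i,
      forall i, (minn l m <= i)%N -> s i = 0 &
      A = U *m rect_diag l m (minn l m) s *m V^T].

(* [xget] selects the element of a set, here the unique sequence of singular
   values of A. *)
Definition singular_values (R : realType) (l m : nat) (A : 'M[R]_(l, m)) :
    nat -> R :=
  xget (fun=> 0) [set s | exists U V, is_svd A U s V].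

(* sigma_k(A), with k counted from 1 *)
Definition sigma (R : realType) (l m : nat) (k : nat) (A : 'M[R]_(l, m)) : R :=
  singular_values A k.-1.

Definition fixed_rank (R : realType) (l m r : nat) : set 'M[R]_(l, m) :=
  [set A | \rank A = r].

(* Truncated SVD, obtained from any SVD of A by keeping the r largest singular
   values; independent of the SVD when sigma_r(A) > sigma_(r+1)(A). *)
Definition proj_fixed_rank (R : realType) (l m r : nat) (A : 'M[R]_(l, m)) :
    'M[R]_(l, m) :=
  xget 0 [set B | exists U s V,
    is_svd A U s V /\ B = U *m rect_diag l m r s *m V^T].

(* Velocities at A of the C^1 curves drawn on the fixed rank manifold. *)
Definition tangent_space (R : realType) (l m r : nat) (A : 'M[R]_(l, m)) :
    set 'M[R]_(l, m) :=
  [set X | exists g : R -> 'M[R]_(l, m),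
    [/\ \forall s \near (0 : R), fixed_rank r (g s),
        \forall s \near (0 : R),
          derivable g s 1 /\ {for s, continuous (derive1 g)},
        g 0 = A &
        derive1 g 0 = X]].

(* Orthogonal projection onto a linear subspace S. *)
Definition orth_proj (R : realType) (l m : nat) (S : set 'M[R]_(l, m))
    (X : 'M[R]_(l, m)) : 'M[R]_(l, m) :=
  xget 0 [set Y | S Y /\ forall Z, S Z -> fdot (X - Y) Z = 0].

(* f is differentiable at t relatively to D, with derivative v: one-sided
   derivatives at the end points when D is an interval. *)
Definition has_derivative_within (R : realType) (V : normedModType R)
    (D : set R) (f : R -> V) (t : R) (v : V) : Prop :=
  (s - t)^-1 *: (f s - f t) @[s --> within (D `\ t) (nbhs t)] --> v.

Definition solves_on (R : realType) (l m : nat) (D : set R)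
    (F : R -> 'M[R]_(l, m) -> 'M[R]_(l, m)) (X : R -> 'M[R]_(l, m)) : Prop :=
  forall t, D t -> has_derivative_within D X t (F t (X t)).

(* Main.v *)
Require Import Defs.
From HB Require Import structures.
From mathcomp Require Import all_boot all_order all_algebra.
From mathcomp Require Import all_classical all_reals all_analysis.
From mathcomp Require Import measurable_realfun.
From mathcomp Require Import ring lra.
Import Order.TTheory GRing.Theory Num.Theory.
Import numFieldNormedType.Exports.

(** Write [Z] for the rank [r] truncation of the exact solution [X], and [N] for
    the residual [X - Z].  Two perturbation estimates drive the proof.  First,
    the best approximation moves like the tangential part of [X]: to first
    order, the discrepancy has norm at most
    [sigma_(r+1) / (sigma_r - sigma_(r+1)) * |L(X)|], and
    [sigma_(r+1) <= |N|].  Second, the tangent projectors at [Y] and [Z] satisfy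
    [<Y - Z, (P_Y - P_Z) F> <= 2 / sigma_r * |Y - Z|^2 * |F|], because the normal
    part at one rank [r] matrix of another one is quadratic in their distance.
    Hence the upper right Dini derivative of [|Y - Z|] is at most
    [eta |Y - Z| + |N| (K + |L(X)| / (sigma_r - sigma_(r+1)))].  Working with a
    Dini derivative avoids differentiating the truncation or the norm at [0].
    The right-hand side is only measurable in time ([L] is not assumed
    continuous in [t], but [L(t, X t)] is a pointwise limit of difference
    quotients of [X]), so the inequality is integrated by dominated
    convergence of the difference quotients of [exp(- eta t) |Y - Z|]. *)

Set Implicit Arguments.
Unset Strict Implicit.
Unset Printing Implicit Defensive.

Local Open Scope classical_set_scope.
Local Open Scope ring_scope.

(** * Frobenius inner product and norm *)

Section Frobenius.
Variable R : realType.

Lemma fdotE l m (A B : 'M[R]_(l, m)) :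
  fdot A B = \sum_i \sum_j A i j * B i j.
Proof.
rewrite /fdot /mxtrace exchange_big /=.
apply: eq_bigr => j _; rewrite mxE; apply: eq_bigr => i _.
by rewrite mxE.
Qed.

Lemma fdotC l m (A B : 'M[R]_(l, m)) : fdot A B = fdot B A.
Proof.
by rewrite !fdotE; do 2!apply: eq_bigr => ? _; rewrite mulrC.
Qed.

Lemma fdotDr l m (A B C : 'M[R]_(l, m)) : fdot A (B + C) = fdot A B + fdot A C.
Proof. by rewrite /fdot mulmxDr mxtraceD. Qed.

Lemma fdotNr l m (A B : 'M[R]_(l, m)) : fdot A (- B) = - fdot A B.
Proof. by rewrite /fdot mulmxN raddfN. Qed.

Lemma fdotBr l m (A B C : 'M[R]_(l, m)) : fdot A (B - C) = fdot A B - fdot A C.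
Proof. by rewrite fdotDr fdotNr. Qed.

Lemma fdotZr l m c (A B : 'M[R]_(l, m)) : fdot A (c *: B) = c * fdot A B.
Proof. by rewrite /fdot -scalemxAr mxtraceZ. Qed.

Lemma fdotDl l m (A B C : 'M[R]_(l, m)) : fdot (A + B) C = fdot A C + fdot B C.
Proof. by rewrite fdotC fdotDr !(fdotC C). Qed.

Lemma fdotNl l m (A B : 'M[R]_(l, m)) : fdot (- A) B = - fdot A B.
Proof. by rewrite fdotC fdotNr fdotC. Qed.

Lemma fdotBl l m (A B C : 'M[R]_(l, m)) : fdot (A - B) C = fdot A C - fdot B C.
Proof. by rewrite fdotDl fdotNl. Qed.

Lemma fdotZl l m c (A B : 'M[R]_(l, m)) : fdot (c *: A) B = c * fdot A B.
Proof. by rewrite fdotC fdotZr fdotC. Qed.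

Lemma fdot0r l m (A : 'M[R]_(l, m)) : fdot A 0 = 0.
Proof. by rewrite /fdot mulmx0 raddf0. Qed.

Lemma fdot0l l m (A : 'M[R]_(l, m)) : fdot 0 A = 0.
Proof. by rewrite fdotC fdot0r. Qed.

Lemma fdot_tr l m (A B : 'M[R]_(l, m)) : fdot A^T B^T = fdot A B.
Proof. by rewrite /fdot trmxK mxtrace_mulC -mxtrace_tr trmx_mul trmxK. Qed.

Lemma fdot_mulmxl l m k (M : 'M[R]_(l, k)) (A : 'M[R]_(k, m)) (B : 'M[R]_(l, m)) :
  fdot (M *m A) B = fdot A (M^T *m B).
Proof. by rewrite /fdot trmx_mul mulmxA. Qed.

Lemma fdot_mulmxr l m k (A : 'M[R]_(l, k)) (M : 'M[R]_(k, m)) (B : 'M[R]_(l, m)) :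
  fdot (A *m M) B = fdot A (B *m M^T).
Proof. by rewrite -fdot_tr trmx_mul fdot_mulmxl -fdot_tr trmx_mul !trmxK. Qed.

Lemma fdot_ge0 l m (A : 'M[R]_(l, m)) : 0 <= fdot A A.
Proof. by rewrite fdotE; do 2!apply: sumr_ge0 => ? _; rewrite -expr2 sqr_ge0. Qed.

Lemma fnorm_ge0 l m (A : 'M[R]_(l, m)) : 0 <= fnorm A.
Proof. exact: sqrtr_ge0. Qed.

Lemma sqr_fnorm l m (A : 'M[R]_(l, m)) : fnorm A ^+ 2 = fdot A A.
Proof. by rewrite sqr_sqrtr ?fdot_ge0. Qed.

Lemma ler_fnormP l m (A : 'M[R]_(l, m)) c :
  0 <= c -> fdot A A <= c ^+ 2 -> fnorm A <= c.
Proof. by move=> c0 h; rewrite -(ler_pXn2r (n := 2)) ?nnegrE ?fnorm_ge0 ?sqr_fnorm. Qed.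

Lemma fnorm0 l m : fnorm (0 : 'M[R]_(l, m)) = 0.
Proof. by rewrite /fnorm fdot0r sqrtr0. Qed.

Lemma fnorm_entry l m (A : 'M[R]_(l, m)) i j : `|A i j| <= fnorm A.
Proof.
rewrite -(ler_pXn2r (n := 2)) ?nnegrE ?fnorm_ge0 // sqr_fnorm fdotE.
rewrite (bigD1 i) //= (bigD1 j) //= -addrA real_normK ?num_real // -expr2 lerDl.
by rewrite addr_ge0 //; do ?[apply: sumr_ge0 => ? _]; rewrite -expr2 sqr_ge0.
Qed.

Lemma fnorm_eq0 l m (A : 'M[R]_(l, m)) : fnorm A = 0 -> A = 0.
Proof.
move=> A0; apply/matrixP => i j; apply/eqP; rewrite mxE -normr_le0 -A0.
exact: fnorm_entry.
Qed.

(** Cauchy-Schwarz, by expanding the squared norm of [fnorm B *: A - fnorm A *: B]. *)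
Lemma fdot_le l m (A B : 'M[R]_(l, m)) : fdot A B <= fnorm A * fnorm B.
Proof.
have [A0|A0] := eqVneq (fnorm A) 0.
  by rewrite (fnorm_eq0 A0) fdot0l fnorm0 mul0r.
have [B0|B0] := eqVneq (fnorm B) 0.
  by rewrite (fnorm_eq0 B0) fdot0r fnorm0 mulr0.
have a0 : 0 < fnorm A by rewrite lt_def A0 fnorm_ge0.
have b0 : 0 < fnorm B by rewrite lt_def B0 fnorm_ge0.
have := fdot_ge0 (fnorm B *: A - fnorm A *: B).
rewrite fdotBl !fdotBr !fdotZl !fdotZr (fdotC B A) -!sqr_fnorm => h.
have : 0 <= (fnorm A * fnorm B) * (fnorm A * fnorm B - fdot A B) by lra.
by rewrite pmulr_rge0 ?mulr_gt0 // subr_ge0.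
Qed.

Lemma fnormN l m (A : 'M[R]_(l, m)) : fnorm (- A) = fnorm A.
Proof. by rewrite /fnorm fdotNl fdotNr opprK. Qed.

Lemma fnormB l m (A B : 'M[R]_(l, m)) : fnorm (A - B) = fnorm (B - A).
Proof. by rewrite -fnormN opprB. Qed.

Lemma fnormZ l m c (A : 'M[R]_(l, m)) : fnorm (c *: A) = `|c| * fnorm A.
Proof.
rewrite /fnorm fdotZl fdotZr mulrA -expr2 sqrtrM ?sqr_ge0 //.
by rewrite sqrtr_sqr.
Qed.

Lemma fnorm_tr l m (A : 'M[R]_(l, m)) : fnorm A^T = fnorm A.
Proof. by rewrite /fnorm fdot_tr. Qed.

Lemma fnormD l m (A B : 'M[R]_(l, m)) : fnorm (A + B) <= fnorm A + fnorm B.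
Proof.
apply: ler_fnormP; first by rewrite addr_ge0 ?fnorm_ge0.
rewrite fdotDl !fdotDr (fdotC B A) -!sqr_fnorm.
by have := fdot_le A B; lra.
Qed.

Lemma fnorm_triB l m (A B C : 'M[R]_(l, m)) :
  fnorm (A - C) <= fnorm (A - B) + fnorm (B - C).
Proof. by rewrite -[A - C](subrKA B) fnormD. Qed.

Lemma ler_fnormB l m (A B : 'M[R]_(l, m)) : `|fnorm A - fnorm B| <= fnorm (A - B).
Proof.
have h1 := fnormD (A - B) B; have h2 := fnormD (B - A) A.
rewrite !subrK (fnormB B A) in h1 h2.
rewrite ler_norml; lra.
Qed.

(** Cauchy-Schwarz bounds each entry of the product by the norms of a row of [A] and a column of
    [B]; the squares are then summed. *)
Lemma fnormM l m k (A : 'M[R]_(l, k)) (B : 'M[R]_(k, m)) :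
  fnorm (A *m B) <= fnorm A * fnorm B.
Proof.
apply: ler_fnormP; first by rewrite mulr_ge0 ?fnorm_ge0.
rewrite exprMn !sqr_fnorm !fdotE.
have rowcol i j : (A *m B) i j * (A *m B) i j <=
   (\sum_k0 A i k0 * A i k0) * (\sum_k0 B k0 j * B k0 j).
  have := fdot_le (row i A) (col j B)^T.
  have -> : fdot (row i A) (col j B)^T = (A *m B) i j.
    by rewrite fdotE big_ord1 mxE; apply: eq_bigr => x _; rewrite !mxE.
  (* The opposite column bounds the entry from below, so that its square is controlled. *)
  have := fdot_le (row i A) (- (col j B)^T).
  rewrite fdotNr fnormN.
  have -> : fdot (row i A) (col j B)^T = (A *m B) i j.
    by rewrite fdotE big_ord1 mxE; apply: eq_bigr => x _; rewrite !mxE.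
  have -> : \sum_k0 A i k0 * A i k0 = fnorm (row i A) ^+ 2.
    by rewrite sqr_fnorm fdotE big_ord1; apply: eq_bigr => x _; rewrite !mxE.
  have -> : \sum_k0 B k0 j * B k0 j = fnorm (col j B)^T ^+ 2.
    by rewrite sqr_fnorm fdotE big_ord1; apply: eq_bigr => x _; rewrite !mxE.
  move=> h1 h2; rewrite -exprMn -expr2 -[leLHS]real_normK ?num_real //.
  rewrite ler_pXn2r ?nnegrE ?mulr_ge0 ?fnorm_ge0 // ler_norml; lra.
apply: (@le_trans _ _ (\sum_i \sum_j
   (\sum_k0 A i k0 * A i k0) * (\sum_k0 B k0 j * B k0 j))).
  by do 2!apply: ler_sum => ? _.
rewrite [X in _ * X]exchange_big /= mulr_suml.
by apply: ler_sum => i _; rewrite mulr_sumr.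
Qed.

End Frobenius.

(** * Orthogonal projectors *)

Section OrthogonalProjector.
Variable R : realType.

Definition orthoproj n (P : 'M[R]_n) := P *m P = P /\ P^T = P.

Lemma orthoprojC n (P : 'M[R]_n) : orthoproj P -> orthoproj (1%:M - P).
Proof.
move=> [PP PT]; split; last by rewrite linearB /= trmx1 PT.
by rewrite mulmxBl mul1mx mulmxBr mulmx1 PP subrr subr0.
Qed.

Lemma sqr_fnorm_projl n m (P : 'M[R]_n) (A : 'M[R]_(n, m)) : orthoproj P ->
  fnorm A ^+ 2 = fnorm (P *m A) ^+ 2 + fnorm ((1%:M - P) *m A) ^+ 2.
Proof.
move=> hP; have [PP PT] := hP; have [CC CT] := orthoprojC hP.
rewrite !sqr_fnorm !fdot_mulmxl !mulmxA PT CT PP CC.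
by rewrite -fdotDr -mulmxDl addrC subrK mul1mx.
Qed.

Lemma sqr_fnorm_projr n m (P : 'M[R]_n) (A : 'M[R]_(m, n)) : orthoproj P ->
  fnorm A ^+ 2 = fnorm (A *m P) ^+ 2 + fnorm (A *m (1%:M - P)) ^+ 2.
Proof.
move=> hP; have [_ PT] := hP; have [_ CT] := orthoprojC hP.
rewrite -fnorm_tr (sqr_fnorm_projl _ hP) -fnorm_tr -(fnorm_tr (_ *m A^T)).
by rewrite !trmx_mul trmxK PT CT.
Qed.

Lemma fnorm_projl n m (P : 'M[R]_n) (A : 'M[R]_(n, m)) :
  orthoproj P -> fnorm (P *m A) <= fnorm A.
Proof.
move=> hP; rewrite -(ler_pXn2r (n := 2)) ?nnegrE ?fnorm_ge0 //.
by rewrite (sqr_fnorm_projl A hP) lerDl sqr_ge0.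
Qed.

Lemma fnorm_projr n m (P : 'M[R]_n) (A : 'M[R]_(m, n)) :
  orthoproj P -> fnorm (A *m P) <= fnorm A.
Proof.
move=> hP; rewrite -(ler_pXn2r (n := 2)) ?nnegrE ?fnorm_ge0 //.
by rewrite (sqr_fnorm_projr A hP) lerDl sqr_ge0.
Qed.

(* Both sides are [tr P - tr (P P')]. *)
Lemma fnorm_projC n (P P' : 'M[R]_n) : orthoproj P -> orthoproj P' ->
  \tr P = \tr P' -> fnorm ((1%:M - P) *m P') = fnorm ((1%:M - P') *m P).
Proof.
have aux (A B : 'M[R]_n) : orthoproj A -> orthoproj B ->
    fdot ((1%:M - A) *m B) ((1%:M - A) *m B) = \tr B - \tr (A *m B).
  move=> hA [BB BT]; have [CC CT] := orthoprojC hA.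
  rewrite fdot_mulmxl CT mulmxA CC /fdot BT mulmxBl mul1mx mulmxBr BB raddfB /=.
  by rewrite mulmxA -mulmxA mxtrace_mulC -mulmxA BB.
by move=> hP hP' tPP'; rewrite /fnorm !aux // mxtrace_mulC tPP'.
Qed.

End OrthogonalProjector.

(** * Perturbation of the rank [r] truncation *)

Section Truncation.
Variable R : realType.

(* The spectral norm of [A] is at most [c]. *)
Definition opbound (c : R) l m (A : 'M[R]_(l, m)) :=
  forall k (B : 'M[R]_(m, k)), fnorm (A *m B) <= c * fnorm B.

Lemma opbound_fnorm l m (A : 'M[R]_(l, m)) : opbound (fnorm A) A.
Proof. by move=> k B; exact: fnormM. Qed.

(** [|B A|^2 = <B, B A A^T>]; the bound on [A] is applied to [(B A)^T], and one factor [|B A|]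
    cancels. This is the equality of the spectral norms of [A] and [A^T]. *)
Lemma opbound_mulr c l m (A : 'M[R]_(l, m)) : 0 <= c -> opbound c A ->
  forall k (B : 'M[R]_(k, l)), fnorm (B *m A) <= c * fnorm B.
Proof.
move=> c0 hA k B; have [->|n0] := eqVneq (fnorm (B *m A)) 0.
  by rewrite mulr_ge0 ?fnorm_ge0.
have n_gt0 : 0 < fnorm (B *m A) by rewrite lt_def n0 fnorm_ge0.
rewrite -(ler_pM2r n_gt0) -expr2 sqr_fnorm fdot_mulmxr.
apply: le_trans (fdot_le _ _) _.
rewrite -mulrA mulrCA ler_wpM2l ?fnorm_ge0 //.
by have := hA _ (B *m A)^T; rewrite -fnorm_tr trmx_mul trmxK fnorm_tr.
Qed.

(* The Moore-Penrose conditions on [W] that are needed: [A W] and [W A] are the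
   orthogonal projectors on the column and row spaces of [A]. *)
Definition pinv l m (r : nat) (A : 'M[R]_(l, m)) (W : 'M[R]_(m, l)) :=
  [/\ A *m W *m A = A, (A *m W)^T = A *m W, (W *m A)^T = W *m A &
      \tr (A *m W) = r%:R].

Lemma pinv_orthoprojl l m r (A : 'M[R]_(l, m)) W :
  pinv r A W -> orthoproj (A *m W).
Proof. by case=> AWA PT _ _; split; rewrite // mulmxA AWA. Qed.

Lemma pinv_orthoprojr l m r (A : 'M[R]_(l, m)) W :
  pinv r A W -> orthoproj (W *m A).
Proof. by case=> AWA _ QT _; split; rewrite // -mulmxA (mulmxA A) AWA. Qed.

Lemma pinv_subl l m r (A : 'M[R]_(l, m)) W :
  pinv r A W -> (1%:M - A *m W) *m A = 0.
Proof. by case=> AWA _ _ _; rewrite mulmxBl mul1mx AWA subrr. Qed.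

Lemma pinv_subr l m r (A : 'M[R]_(l, m)) W :
  pinv r A W -> A *m (1%:M - W *m A) = 0.
Proof. by case=> AWA _ _ _; rewrite mulmxBr mulmx1 mulmxA AWA subrr. Qed.

(* The projector on the normal space at [A] of the fixed rank manifold. *)
Definition normal_part l m (A : 'M[R]_(l, m)) (W : 'M[R]_(m, l)) (B : 'M[R]_(l, m)) :=
  (1%:M - A *m W) *m B *m (1%:M - W *m A).

Lemma normal_partB l m (A : 'M[R]_(l, m)) W B C :
  normal_part A W (B - C) = normal_part A W B - normal_part A W C.
Proof. by rewrite /normal_part (mulmxBr _ B C) (mulmxBl _ _ (1%:M - W *m A)). Qed.

Lemma normal_partZ l m (A : 'M[R]_(l, m)) W c B :
  normal_part A W (c *: B) = c *: normal_part A W B.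
Proof. by rewrite /normal_part -scalemxAr -scalemxAl. Qed.

Lemma normal_part_id l m r (A : 'M[R]_(l, m)) W :
  pinv r A W -> normal_part A W A = 0.
Proof. by move=> h; rewrite /normal_part (pinv_subl h) mul0mx. Qed.

Lemma normal_part_sym l m r (A : 'M[R]_(l, m)) W B C : pinv r A W ->
  fdot (normal_part A W B) C = fdot B (normal_part A W C).
Proof.
move=> h; have [_ PT] := orthoprojC (pinv_orthoprojl h).
have [_ QT] := orthoprojC (pinv_orthoprojr h).
by rewrite /normal_part fdot_mulmxr QT fdot_mulmxl PT mulmxA.
Qed.

Lemma normal_part_idem l m r (A : 'M[R]_(l, m)) W B : pinv r A W ->
  normal_part A W (normal_part A W B) = normal_part A W B.
Proof.
move=> h; have [PP _] := orthoprojC (pinv_orthoprojl h).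
have [QQ _] := orthoprojC (pinv_orthoprojr h).
by rewrite /normal_part !mulmxA PP -mulmxA QQ.
Qed.

Lemma fnorm_normal_part l m r (A : 'M[R]_(l, m)) W B : pinv r A W ->
  fnorm (normal_part A W B) <= fnorm B.
Proof.
move=> h; apply: le_trans (fnorm_projr _ (orthoprojC (pinv_orthoprojr h))) _.
exact: fnorm_projl _ (orthoprojC (pinv_orthoprojl h)).
Qed.

Lemma fnorm_tangent_part l m r (A : 'M[R]_(l, m)) W B : pinv r A W ->
  fnorm (B - normal_part A W B) <= fnorm B.
Proof.
move=> h; apply: ler_fnormP; first exact: fnorm_ge0.
rewrite sqr_fnorm fdotBl !fdotBr.
have := fdot_ge0 (normal_part A W B).
rewrite (normal_part_sym B (normal_part A W B) h) (normal_part_idem _ h).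
rewrite (normal_part_sym B B h); lra.
Qed.

(* [A = A W A] makes [A] quadratic in a displacement when it is compressed by
   the normal projectors of a nearby [B]. *)
Lemma fnorm_normal_part_le l m r r' (A B : 'M[R]_(l, m)) W V w :
  pinv r A W -> pinv r' B V -> 0 <= w -> opbound w W ->
  fnorm (normal_part B V A) <= w * fnorm (B - A) ^+ 2.
Proof.
move=> hA hB w0 hW; have [AWA _ _ _] := hA.
have -> : normal_part B V A =
    ((1%:M - B *m V) *m (A - B)) *m W *m ((A - B) *m (1%:M - V *m B)).
  rewrite mulmxBr (pinv_subl hB) subr0 (mulmxBl A) (pinv_subr hB) subr0.
  by rewrite /normal_part -{1}AWA !mulmxA.
rewrite -mulmxA; apply: le_trans (fnormM _ _) _; rewrite expr2 mulrCA (fnormB B).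
apply: ler_pM; rewrite ?fnorm_ge0 //.
  exact: fnorm_projl _ (orthoprojC (pinv_orthoprojl hB)).
apply: le_trans (hW _ _) _; rewrite ler_wpM2l //.
exact: fnorm_projr _ (orthoprojC (pinv_orthoprojr hB)).
Qed.

(** Equal ranks let the two projectors be exchanged by [fnorm_projC]. The complement of the
    projector of [B] kills [B], which brings in [A - B] and leaves [W] as the pseudoinverse to
    bound. *)
Lemma fnorm_projC_pinv l m r (A B : 'M[R]_(l, m)) W V w :
  pinv r A W -> pinv r B V -> 0 <= w -> opbound w W ->
  fnorm ((1%:M - A *m W) *m (B *m V)) <= w * fnorm (B - A).
Proof.
move=> hA hB w0 hW; have [_ _ _ tA] := hA; have [_ _ _ tB] := hB.
rewrite (fnorm_projC (pinv_orthoprojl hA) (pinv_orthoprojl hB)) ?tA ?tB //.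
have -> : (1%:M - B *m V) *m (A *m W) = (1%:M - B *m V) *m (A - B) *m W.
  by rewrite mulmxBr (pinv_subl hB) subr0 mulmxA.
apply: le_trans (opbound_mulr w0 hW _) _; rewrite ler_wpM2l // (fnormB B).
exact: fnorm_projl _ (orthoprojC (pinv_orthoprojl hB)).
Qed.

(** Counterpart of [fnorm_normal_part_le] with the pseudoinverse bounded at the base point of the
    projection. One factor [|B - A|] is the rotation of the column spaces, the other comes from
    [A (1 - W A) = 0]. With both estimates, [sigma_r] of the exact solution is the one constant that
    enters. *)
Lemma fnorm_normal_part_rank l m r (A B : 'M[R]_(l, m)) W V w :
  pinv r A W -> pinv r B V -> 0 <= w -> opbound w W ->
  fnorm (normal_part A W B) <= w * fnorm (B - A) ^+ 2.
Proof.
move=> hA hB w0 hW; have [BVB _ _ _] := hB.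
have -> : normal_part A W B =
    ((1%:M - A *m W) *m (B *m V)) *m ((B - A) *m (1%:M - W *m A)).
  by rewrite (mulmxBl B) (pinv_subr hA) subr0 /normal_part -{1}BVB !mulmxA.
apply: le_trans (fnormM _ _) _; rewrite expr2 mulrA.
apply: ler_pM; rewrite ?fnorm_ge0 //; first exact: fnorm_projC_pinv hB w0 hW.
exact: fnorm_projr _ (orthoprojC (pinv_orthoprojr hA)).
Qed.

(* [Z] is the rank [r] truncation of [A], with [a] and [b] standing for
   [sigma_r(A)] and [sigma_(r+1)(A)]. *)
Record truncation l m (r : nat) (A Z : 'M[R]_(l, m)) (W : 'M[R]_(m, l)) (a b : R) := Truncation {
  trunc_pinv : pinv r Z W;
  trunc_projl : Z *m W *m (A - Z) = 0;
  trunc_projr : (A - Z) *m (W *m Z) = 0;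
  trunc_a : 0 < a;
  trunc_b : 0 <= b;
  trunc_opboundW : opbound a^-1 W;
  trunc_opboundN : opbound b (A - Z);
  trunc_b_le : b <= fnorm (A - Z) }.

Section TwoPoints.
Variables (l m r : nat) (A A' Z Z' : 'M[R]_(l, m)) (W W' : 'M[R]_(m, l)).
Variables a b a' b' : R.
Hypotheses (h : truncation r A Z W a b) (h' : truncation r A' Z' W' a' b').

Let P := Z *m W. Let Q := W *m Z.
Let P' := Z' *m W'. Let Q' := W' *m Z'.
Let N := A - Z. Let N' := A' - Z'.

Let hP : orthoproj P. Proof. exact: pinv_orthoprojl (trunc_pinv h). Qed.
Let hQ : orthoproj Q. Proof. exact: pinv_orthoprojr (trunc_pinv h). Qed.
Let hP' : orthoproj P'. Proof. exact: pinv_orthoprojl (trunc_pinv h'). Qed.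
Let hQ' : orthoproj Q'. Proof. exact: pinv_orthoprojr (trunc_pinv h'). Qed.

Let NC : N = (1%:M - P) *m N.
Proof. by rewrite mulmxBl mul1mx (trunc_projl h) subr0. Qed.

Let CN : N = N *m (1%:M - Q).
Proof. by rewrite mulmxBr mulmx1 (trunc_projr h) subr0. Qed.

(** Since [N = (1 - P) N], the product is [P' (1 - P) N], and the transpose of [P' (1 - P)] is
    [(1 - P) Z' W']. The factors [b] and [1 / a'] bound [N] and [W']. *)
Lemma fnorm_proj_residual :
  fnorm (P' *m N) <= b / a' * fnorm ((1%:M - P) *m Z').
Proof.
have [_ PT] := orthoprojC hP; have [_ PT'] := hP'.
have a0 : 0 <= a'^-1 by rewrite invr_ge0 ltW // (trunc_a h').
rewrite NC mulmxA.
apply: le_trans (opbound_mulr (trunc_b h) (trunc_opboundN h) _) _.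
rewrite -mulrA ler_wpM2l ?(trunc_b h) //.
rewrite -fnorm_tr trmx_mul PT PT' mulmxA.
exact: (opbound_mulr a0 (trunc_opboundW h')).
Qed.

Lemma fnorm_residual_proj :
  fnorm (N *m Q') <= b / a' * fnorm (Z' *m (1%:M - Q)).
Proof.
have [_ QT] := orthoprojC hQ; have [_ QT'] := hQ'.
rewrite CN -mulmxA; apply: le_trans (trunc_opboundN h _) _.
rewrite -mulrA ler_wpM2l ?(trunc_b h) //.
rewrite -fnorm_tr trmx_mul QT QT' -mulmxA.
exact: (trunc_opboundW h').
Qed.

Lemma fdot_residual : fdot Z' N <=
  b / a' * (fnorm ((1%:M - P) *m Z') * fnorm (Z' *m (1%:M - Q))).
Proof.
have [_ QT] := orthoprojC hQ; have [_ PT'] := hP'.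
have [Z'WZ _ _ _] := trunc_pinv h'.
have -> : fdot Z' N = fdot (Z' *m (1%:M - Q)) (P' *m N).
  by rewrite fdot_mulmxr QT -mulmxA -CN -PT' -fdot_mulmxl Z'WZ.
apply: le_trans (fdot_le _ _) _; rewrite mulrC mulrA.
by rewrite ler_wpM2r ?fnorm_ge0 // fnorm_proj_residual.
Qed.

(** Pythagoras along [P]: the complementary component of [Z' - Z] is [(1 - P) Z'], and the component
    along [P], multiplied by [1 - Q'], is [- Z (1 - Q')]. *)
Lemma sqr_fnorm_diff_ge :
  fnorm ((1%:M - P) *m Z') ^+ 2 + fnorm (Z *m (1%:M - Q')) ^+ 2
    <= fnorm (Z' - Z) ^+ 2.
Proof.
rewrite (sqr_fnorm_projl (Z' - Z) hP) addrC lerD //.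
  rewrite ler_pXn2r ?nnegrE ?fnorm_ge0 // -(fnormN (P *m _)) -(mulmxN P) opprB.
  apply: le_trans (fnorm_projr _ (orthoprojC hQ')).
  rewrite -mulmxA mulmxBl (pinv_subr (trunc_pinv h')) subr0 mulmxA.
  by have [-> _ _ _] := trunc_pinv h.
by rewrite mulmxBr (pinv_subl (trunc_pinv h)) subr0.
Qed.

End TwoPoints.

Lemma fdot_trunc_residual l m r (A Z : 'M[R]_(l, m)) W a b :
  truncation r A Z W a b -> fdot Z (A - Z) = 0.
Proof.
move=> h; have [ZWZ PT _ _] := trunc_pinv h.
by rewrite -[X in fdot X]ZWZ fdot_mulmxl PT (trunc_projl h) fdot0r.
Qed.

(** Pair [Z' - Z] with [A' - A]. The cross terms [<Z', A - Z>] and [<Z, A' - Z'>] are products of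
    deviations between the singular subspaces, and together consume at most the fraction [q] of
    [|Z' - Z|^2]. *)
Lemma truncation_lipschitz l m r (A A' Z Z' : 'M[R]_(l, m)) W W' a b a' b' q :
  truncation r A Z W a b -> truncation r A' Z' W' a' b' ->
  b <= q * a' -> b' <= q * a -> (1 - q) * fnorm (Z' - Z) <= fnorm (A' - A).
Proof.
move=> h h' hb hb'.
have a0 := trunc_a h; have a0' := trunc_a h'.
have q1 : b / a' <= q by rewrite ler_pdivrMr.
have q2 : b' / a <= q by rewrite ler_pdivrMr.
have e1 := fdot_residual h h'; have e2 := fdot_residual h' h.
have s1 := sqr_fnorm_diff_ge h h'; have s2 := sqr_fnorm_diff_ge h' h.
rewrite (fnormB Z Z') in s2.
set x1 := fnorm _ in e1 s1; set y1 := fnorm (Z' *m _) in e1 s2.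
set x2 := fnorm _ in e2 s2; set y2 := fnorm (Z *m _) in e2 s1.
have x1_ge0 : 0 <= x1 := fnorm_ge0 _. have y1_ge0 : 0 <= y1 := fnorm_ge0 _.
have x2_ge0 : 0 <= x2 := fnorm_ge0 _. have y2_ge0 : 0 <= y2 := fnorm_ge0 _.
have q0 : 0 <= q.
  by apply: le_trans q1; rewrite mulr_ge0 ?invr_ge0 ?(trunc_b h) // ltW.
have f1 : fdot Z' (A - Z) <= q * (x1 * y1).
  by apply: le_trans e1 _; rewrite ler_wpM2r // mulr_ge0.
have f2 : fdot Z (A' - Z') <= q * (x2 * y2).
  by apply: le_trans e2 _; rewrite ler_wpM2r // mulr_ge0.
(* AM-GM on each product, then the two symmetric instances of [sqr_fnorm_diff_ge]. *)
have f3 : q * (x1 * y1 + x2 * y2) <= q * fnorm (Z' - Z) ^+ 2.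
  rewrite ler_wpM2l //.
  by have := sqr_ge0 (x1 - y1); have := sqr_ge0 (x2 - y2); rewrite !sqrrB; lra.
have f4 : fnorm (Z' - Z) ^+ 2 =
    fdot (Z' - Z) (A' - A) + fdot Z (A' - Z') + fdot Z' (A - Z).
  have := fdot_trunc_residual h; have := fdot_trunc_residual h'.
  rewrite sqr_fnorm !fdotBl !fdotBr; lra.
have f5 := fdot_le (Z' - Z) (A' - A).
have [->|d0] := eqVneq (fnorm (Z' - Z)) 0; first by rewrite mulr0 fnorm_ge0.
have d_gt0 : 0 < fnorm (Z' - Z) by rewrite lt_def d0 fnorm_ge0.
rewrite -(ler_pM2l d_gt0); lra.
Qed.

(** The error splits into the normal part of [Z'] at [Z], which is quadratic, and the tangential
    part at [Z] of the residual [A' - Z'], which is of first order with factor [b' / a]. Multiplied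
    by the Lipschitz constant of the truncation, this factor becomes
    [sigma_(r+1) / (sigma_r - sigma_(r+1))] in the limit. *)
Lemma truncation_expansion l m r (A A' Z Z' : 'M[R]_(l, m)) W W' a b a' b' :
  truncation r A Z W a b -> truncation r A' Z' W' a' b' ->
  fnorm (Z' - Z - ((A' - A) - normal_part Z W (A' - A))) <=
  b' / a * fnorm (Z' - Z) + (a'^-1 + b' / a * a^-1) * fnorm (Z' - Z) ^+ 2.
Proof.
move=> h h'; have pZ := trunc_pinv h; have pZ' := trunc_pinv h'.
have a0 := trunc_a h; have a0' := trunc_a h'.
have hP := pinv_orthoprojl pZ; have hQ' := pinv_orthoprojr pZ'.
have hQ := pinv_orthoprojr pZ; have hP' := pinv_orthoprojl pZ'.
set N := A - Z; set N' := A' - Z'.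
have normN : normal_part Z W N = N.
  rewrite /normal_part mulmxBl mul1mx (trunc_projl h) subr0.
  by rewrite mulmxBr mulmx1 (trunc_projr h) subr0.
have -> : Z' - Z - ((A' - A) - normal_part Z W (A' - A)) =
    normal_part Z W Z' - (N' - normal_part Z W N').
  have -> : A' - A = (Z' - Z) - (N - N').
    by apply/matrixP => i j; rewrite !mxE; ring.
  rewrite (normal_partB _ _ (Z' - Z)) (normal_partB _ _ Z') (normal_partB _ _ N).
  rewrite normN (normal_part_id pZ).
  move: (normal_part Z W Z') (normal_part Z W N') => U V.
  by apply/matrixP => i j; rewrite !mxE; ring.
rewrite mulrDl addrCA; apply: le_trans (fnormD _ _) _.
rewrite fnormN; apply: lerD.
  rewrite (fnormB Z').
  by apply: (fnorm_normal_part_le pZ' pZ) (trunc_opboundW h'); rewrite invr_ge0 ltW.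
have q0 : 0 <= b' / a by rewrite mulr_ge0 ?invr_ge0 ?(trunc_b h') // ltW.
have c0 : 0 <= fnorm (Z' - Z) + a^-1 * fnorm (Z' - Z) ^+ 2.
  by rewrite addr_ge0 ?fnorm_ge0 // mulr_ge0 ?sqr_ge0 // invr_ge0 ltW.
rewrite -(mulrA (b' / a)) -mulrDr; apply: ler_fnormP; first by rewrite mulr_ge0.
(* With [P = Z W] and [Q = W Z], the tangential part of [N'] has the orthogonal pieces [P N'] and
   [(1 - P) N' Q]. *)
rewrite -sqr_fnorm (sqr_fnorm_projl _ hP).
have -> : Z *m W *m (N' - normal_part Z W N') = Z *m W *m N'.
  rewrite (mulmxBr (Z *m W) N') /normal_part !(mulmxA (Z *m W)).
  by rewrite (mulmxBr (Z *m W) 1%:M) mulmx1 (proj1 hP) subrr !mul0mx subr0.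
have -> : (1%:M - Z *m W) *m (N' - normal_part Z W N') =
    (1%:M - Z *m W) *m (N' *m (W *m Z)).
  rewrite (mulmxBr _ N') /normal_part !(mulmxA (1%:M - Z *m W)).
  rewrite (proj1 (orthoprojC hP)) (mulmxBr _ 1%:M) mulmx1.
  by rewrite opprB addrC subrK -mulmxA.
have e1 : fnorm (Z *m W *m N') <= b' / a * fnorm ((1%:M - Z' *m W') *m Z).
  exact: fnorm_proj_residual h' h.
have e2 : fnorm ((1%:M - Z *m W) *m (N' *m (W *m Z))) <=
    b' / a * fnorm (Z *m (1%:M - W' *m Z')).
  apply: le_trans (fnorm_projl _ (orthoprojC hP)) _.
  exact: fnorm_residual_proj h' h.
have e3 : fnorm ((1%:M - Z' *m W') *m Z) ^+ 2 +
    fnorm (Z' *m W' *m (Z *m (1%:M - W' *m Z'))) ^+ 2 <= fnorm (Z' - Z) ^+ 2.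
  rewrite (sqr_fnorm_projl (Z' - Z) hP') addrC lerD //.
    rewrite ler_pXn2r ?nnegrE ?fnorm_ge0 // -(fnormN (Z' *m W' *m (Z' - Z))) -(mulmxN (Z' *m W')) opprB.
    apply: le_trans (fnorm_projr _ (orthoprojC hQ')).
    by rewrite -(mulmxA (Z' *m W')) (mulmxBl Z) (pinv_subr pZ') subr0.
  by rewrite mulmxBr (pinv_subl pZ') sub0r fnormN.
(* This doubly normal piece of [Z (1 - W' Z')] is the one that [e3] leaves out; being quadratic, it
   contributes to the second order term alone. *)
have e4 : fnorm ((1%:M - Z' *m W') *m (Z *m (1%:M - W' *m Z'))) <=
    a^-1 * fnorm (Z' - Z) ^+ 2.
  rewrite mulmxA.
  by apply: (fnorm_normal_part_le pZ pZ') (trunc_opboundW h); rewrite invr_ge0 ltW.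
have e5 := sqr_fnorm_projl (Z *m (1%:M - W' *m Z')) hP'.
set u := fnorm (_ *m _ *m N') in e1 *.
set v := fnorm (_ *m (N' *m _)) in e2 *.
have u2 : u ^+ 2 <= (b' / a * fnorm ((1%:M - Z' *m W') *m Z)) ^+ 2.
  by rewrite ler_pXn2r ?nnegrE ?fnorm_ge0 ?(mulr_ge0 q0) ?fnorm_ge0.
have v2 : v ^+ 2 <= (b' / a * fnorm (Z *m (1%:M - W' *m Z'))) ^+ 2.
  by rewrite ler_pXn2r ?nnegrE ?fnorm_ge0 ?(mulr_ge0 q0) ?fnorm_ge0.
rewrite exprMn in u2; rewrite exprMn in v2; rewrite exprMn.
apply: le_trans (lerD u2 v2) _; rewrite -mulrDr ler_wpM2l ?sqr_ge0 // e5.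
rewrite addrA; apply: le_trans (lerD e3 (lexx _)) _.
have e4' : fnorm ((1%:M - Z' *m W') *m (Z *m (1%:M - W' *m Z'))) ^+ 2
    <= (a^-1 * fnorm (Z' - Z) ^+ 2) ^+ 2.
  rewrite ler_pXn2r ?nnegrE ?fnorm_ge0 ?mulr_ge0 ?sqr_ge0 ?fnorm_ge0 //.
  by rewrite invr_ge0 ltW.
apply: le_trans (lerD (lexx _) e4') _; rewrite sqrrD [leRHS]addrAC lerDl.
by rewrite mulrn_wge0 // !mulr_ge0 ?fnorm_ge0 ?sqr_ge0 // invr_ge0 ltW.
Qed.

End Truncation.

(** * Singular values: Weyl's inequality, uniqueness, truncated SVD *)

Section SingularValues.
Variable R : realType.

Lemma trmx_rect_diag l m k (s : nat -> R) :
  (rect_diag l m k s)^T = rect_diag m l k s.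
Proof.
apply/matrixP => i j; rewrite !mxE eq_sym.
by case: eqP => //= ->.
Qed.

Lemma rect_diag_mul l n m k (s u : nat -> R) : (k <= n)%N ->
  rect_diag l n k s *m rect_diag n m k u = rect_diag l m k (fun i => s i * u i).
Proof.
move=> kn; apply/matrixP => i j; rewrite !mxE.
case: (ltnP i k) => ik; last first.
  by rewrite andbF big1 // => x _; rewrite !mxE ltnNge ik andbF mul0r.
rewrite (bigD1 (Ordinal (leq_trans ik kn))) //= !mxE eqxx ik /= big1 ?addr0.
  by rewrite !andbT; case: eqP => // _; rewrite mulr0.
move=> x; rewrite -val_eqE /= => xi.
by rewrite !mxE eq_sym (negbTE xi) mul0r.
Qed.

Lemma rect_diag_mulE n p k (s : nat -> R) (B : 'M[R]_(n, p)) i j :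
  (rect_diag n n k s *m B) i j = (if (i < k)%N then s i else 0) * B i j.
Proof.
rewrite mxE (bigD1 i) //= mxE eqxx /= big1 ?addr0 // => x xi.
by rewrite mxE eq_sym val_eqE (negbTE xi) mul0r.
Qed.

Lemma rect_diag_widen l m k k' (s : nat -> R) : (k <= k')%N ->
  rect_diag l m k s = rect_diag l m k' (fun i => if (i < k)%N then s i else 0).
Proof.
move=> kk'; apply/matrixP => i j; rewrite !mxE.
case: (ltnP i k) => ik; first by rewrite (leq_trans ik kk').
by rewrite andbF; case: ifP.
Qed.

Lemma opbound_rect_diag l m k (s : nat -> R) c : 0 <= c -> (k <= l)%N ->
  (forall i, (i < k)%N -> `|s i| <= c) -> opbound c (rect_diag l m k s).
Proof.
move=> c0 kl sc p B; apply: ler_fnormP; first by rewrite mulr_ge0 ?fnorm_ge0.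
rewrite fdot_mulmxl trmx_rect_diag mulmxA rect_diag_mul // exprMn sqr_fnorm.
rewrite !fdotE mulr_sumr; apply: ler_sum => i _; rewrite mulr_sumr.
apply: ler_sum => j _; rewrite rect_diag_mulE mulrCA -expr2.
rewrite ler_wpM2r ?sqr_ge0 //; case: ifP => ik; last exact: sqr_ge0.
rewrite -[leLHS]real_normK ?num_real // ler_pXn2r ?nnegrE //; exact: sc.
Qed.

Lemma fnorm_isometry n p (U : 'M[R]_n) (B : 'M[R]_(n, p)) :
  U^T *m U = 1%:M -> fnorm (U *m B) = fnorm B.
Proof. by move=> UU; rewrite /fnorm fdot_mulmxl mulmxA UU mul1mx. Qed.

Lemma opbound_isometry l m c (S : 'M[R]_(l, m)) (U : 'M[R]_l) (V : 'M[R]_m) :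
  U^T *m U = 1%:M -> V^T *m V = 1%:M -> opbound c S -> opbound c (U *m S *m V^T).
Proof.
move=> UU VV hS p B; rewrite -!mulmxA fnorm_isometry //.
apply: le_trans (hS _ _) _; rewrite (fnorm_isometry (U := V^T)) //.
by rewrite trmxK; apply: mulmx1C.
Qed.

(** In a full rank factorization [P = C D], idempotence forces [D C = 1], and
    [tr (C D) = tr (D C)]. *)
Lemma mxtrace_idem n (P : 'M[R]_n) : P *m P = P -> \tr P = (\rank P)%:R.
Proof.
move=> PP; have [C CE] := row_fullP (col_base_full P).
have [D DE] := row_freeP (row_base_free P).
move: (col_base P) (row_base P) (mulmx_base P) C D CE DE.
move: (\rank P) => k cb rb PE C D CE DE.
have e : rb *m cb = 1%:M.
  have := congr1 (fun X => C *m X *m D) PP.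
  by rewrite -PE !mulmxA CE mul1mx -!mulmxA DE mulmx1.
by rewrite -PE mxtrace_mulC e mxtrace1.
Qed.

Section SVD.
Variables (l m : nat) (A : 'M[R]_(l, m)) (U : 'M[R]_l) (s : nat -> R) (V : 'M[R]_m).
Hypothesis svdA : is_svd A U s V.

Let UU : U^T *m U = 1%:M. Proof. by case: svdA => -[]. Qed.
Let VV : V^T *m V = 1%:M. Proof. by case: svdA => -[]. Qed.

Definition svd_trunc r := U *m rect_diag l m r s *m V^T.

Lemma rank_svd_trunc r : (\rank (svd_trunc r) <= r)%N.
Proof.
have -> : svd_trunc r = (U *m rect_diag l r r (fun=> 1)) *m (rect_diag r m r s *m V^T).
  rewrite /svd_trunc -!mulmxA (mulmxA _ (rect_diag r m r s)) rect_diag_mul //.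
  by congr (_ *m (_ *m _)); apply/matrixP => i j; rewrite !mxE mul1r.
exact: mulmx_max_rank.
Qed.

Lemma svd_residual r : A - svd_trunc r =
  U *m rect_diag l m (minn l m) (fun i => if (i < r)%N then 0 else s i) *m V^T.
Proof.
case: svdA => _ _ _ s0 {1}->; rewrite /svd_trunc -mulmxBl -mulmxBr.
congr (_ *m _ *m _); apply/matrixP => i j; rewrite !mxE.
have [|ip] := leqP (minn l m) i; rewrite ?andbF ?andbT.
  by move/s0 => ->; rewrite sub0r !if_same oppr0.
by case: eqP; case: ltnP => //=; rewrite ?subrr ?subr0.
Qed.

Lemma opbound_svd_residual r : opbound (s r) (A - svd_trunc r).
Proof.
case: svdA => _ s_ge0 smono s0 _; rewrite svd_residual.
apply: opbound_isometry => //; apply: opbound_rect_diag => //; first exact: geq_minl.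
move=> i _; case: ltnP => ri; first by rewrite normr0.
by rewrite ger0_norm // smono.
Qed.

Lemma svd_residual_ge r : s r <= fnorm (A - svd_trunc r).
Proof.
case: svdA => _ s_ge0 smono s0 _; have [/s0->|rp] := leqP (minn l m) r.
  exact: fnorm_ge0.
rewrite svd_residual -fnorm_tr trmx_mul trmxK fnorm_isometry // -fnorm_tr trmxK.
rewrite fnorm_isometry //; move: (rp); rewrite leq_min => /andP[rl rm].
set S := rect_diag _ _ _ _; apply: le_trans (fnorm_entry S (Ordinal rl) (Ordinal rm)).
by rewrite mxE /= eqxx rp ltnn ger0_norm.
Qed.

Lemma truncation_svd r : (0 < r)%N -> 0 < s r.-1 ->
  truncation r A (svd_trunc r) (V *m rect_diag m l r (fun i => (s i)^-1) *m U^T)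
    (s r.-1) (s r).
Proof.
move=> r0 sr; case: (svdA) => _ s_ge0 smono s0 AE.
(* Singular values are padded by zeros from index [minn l m] on, so [0 < s r.-1] bounds [r]. *)
have rp : (r <= minn l m)%N.
  by rewrite leqNgt; apply/negP => pr; move: sr; rewrite s0 ?ltxx // -ltnS prednK.
have [rl rm] : (r <= l)%N /\ (r <= m)%N by apply/andP; rewrite -leq_min.
have s_gt0 i : (i < r)%N -> 0 < s i.
  by move=> ir; apply: lt_le_trans sr _; apply: smono; rewrite -ltnS prednK.
have one n k : rect_diag n k r (fun i => s i * (s i)^-1) = rect_diag n k r (fun=> 1).
  by apply/matrixP => i j; rewrite !mxE; case: andP => // -[_ /s_gt0 h]; rewrite divff ?gt_eqF.
have one' n k : rect_diag n k r (fun i => (s i)^-1 * s i) = rect_diag n k r (fun=> 1).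
  by rewrite -one; congr rect_diag; apply/funext => i; rewrite mulrC.
have ZW : svd_trunc r *m (V *m rect_diag m l r (fun i => (s i)^-1) *m U^T) =
    U *m rect_diag l l r (fun=> 1) *m U^T.
  by rewrite /svd_trunc -!mulmxA (mulmxA V^T) VV mul1mx (mulmxA (rect_diag _ _ _ _)) rect_diag_mul // one.
have WZ : (V *m rect_diag m l r (fun i => (s i)^-1) *m U^T) *m svd_trunc r =
    V *m rect_diag m m r (fun=> 1) *m V^T.
  by rewrite /svd_trunc -!mulmxA (mulmxA U^T) UU mul1mx (mulmxA (rect_diag _ _ _ _)) rect_diag_mul // one'.
split=> //.
- split.
  + rewrite ZW /svd_trunc -!mulmxA (mulmxA U^T) UU mul1mx (mulmxA (rect_diag _ _ _ _)) rect_diag_mul //.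
    by congr (_ *m (_ *m _)); apply/matrixP => i j; rewrite !mxE mul1r.
  + by rewrite ZW !trmx_mul trmxK trmx_rect_diag mulmxA.
  + by rewrite WZ !trmx_mul trmxK trmx_rect_diag mulmxA.
  + rewrite ZW mxtrace_mulC mulmxA UU mul1mx /mxtrace.
    under eq_bigr do rewrite mxE eqxx /=.
    by rewrite -big_mkcond -(big_ord_widen_cond l xpredT (fun=> 1)) //= sumr_const card_ord.
- rewrite ZW svd_residual -!mulmxA (mulmxA U^T) UU mul1mx (mulmxA (rect_diag _ _ _ _)).
  rewrite (rect_diag_widen _ _ _ rp) rect_diag_mul ?geq_minl //.
  rewrite (_ : rect_diag _ _ _ _ = 0) ?mul0mx ?mulmx0 //.
  by apply/matrixP => i j; rewrite !mxE; case: ifP => // _; case: ifP; rewrite ?mulr0 ?mul0r.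
- rewrite WZ svd_residual -!mulmxA (mulmxA V^T) VV mul1mx (mulmxA (rect_diag _ _ _ _)).
  rewrite (rect_diag_widen _ _ _ rp) rect_diag_mul ?geq_minr //.
  rewrite (_ : rect_diag _ _ _ _ = 0) ?mul0mx ?mulmx0 //.
  by apply/matrixP => i j; rewrite !mxE; case: ifP => // _; case: ifP; rewrite ?mulr0 ?mul0r.
- apply: opbound_isometry => //; apply: opbound_rect_diag => //.
    by rewrite invr_ge0 ltW.
  move=> i ir; rewrite ger0_norm ?invr_ge0 // lef_pV2 ?posrE ?s_gt0 ?prednK //.
  by apply: smono; rewrite -ltnS prednK.
- exact: opbound_svd_residual.
- exact: svd_residual_ge.
Qed.

End SVD.

(* Weyl's inequality: the row space of the rank [k+1] truncation of [A] meets
   the kernel of the rank [k] truncation of [B]. *)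
Lemma svd_weyl l m (A B : 'M[R]_(l, m)) U s V U' s' V' k :
  is_svd A U s V -> is_svd B U' s' V' -> s k <= s' k + fnorm (A - B).
Proof.
move=> hA hB; have sk' : 0 <= s' k by case: hB.
have [sk|sk] := leP (s k) 0.
  by apply: le_trans sk _; rewrite addr_ge0 ?fnorm_ge0.
have := truncation_svd hA (ltn0Sn k) sk.
set Z := svd_trunc _ _ _ _; set W := _ *m _ => tA.
have pZ := trunc_pinv tA; have [ZWZ _ QT trP] := pZ; have [QQ _] := pinv_orthoprojr pZ.
have rQ : \rank (W *m Z) = k.+1.
  by apply/eqP; rewrite -(eqr_nat R) -mxtrace_idem // mxtrace_mulC trP.
set Z' := svd_trunc U' s' V' k.
have rZ' : (\rank (W *m Z *m Z'^T) <= k)%N.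
  by apply: leq_trans (mxrankM_maxr _ _) _; rewrite mxrank_tr rank_svd_trunc.
(* The row space has dimension [k + 1] and the kernel has codimension at most [k]. On a common
   nonzero vector, [A] stretches by at least [s k] and [B] by at most [s' k]. *)
have : (0 < \rank (W *m Z :&: kermx Z'^T)%MS)%N.
  by have := mxrank_mul_ker (W *m Z) Z'^T; rewrite rQ; case: (\rank (_ :&: _)%MS) => //; rewrite addn0 => e; move: rZ'; rewrite e ltnn.
rewrite lt0n mxrank_eq0 -nz_row_eq0; set y := nz_row _ => y0.
have : (y <= W *m Z :&: kermx Z'^T)%MS by exact: nz_row_sub.
rewrite sub_capmx => /andP[/submxP[u yu] /sub_kermxP yZ'].
set x := y^T.
have Qx : W *m Z *m x = x by rewrite /x -QT -trmx_mul yu -mulmxA QQ.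
have Z'x : Z' *m x = 0 by rewrite -[Z']trmxK /x -trmx_mul yZ' trmx0.
have Ax : A *m x = Z *m x.
  apply/eqP; rewrite -subr_eq0 -mulmxBl -Qx mulmxA.
  by rewrite (trunc_projr tA) mul0mx.
have Bx : B *m x = (B - Z') *m x by rewrite mulmxBl Z'x subr0.
have x_gt0 : 0 < fnorm x.
  rewrite lt_def fnorm_ge0 andbT; apply: contra y0 => /eqP/fnorm_eq0 x0.
  by rewrite -[y]trmxK -/x x0 trmx0.
(* [x = W (Z x)], and [W] has spectral norm at most [1 / s k]. *)
have h1 : s k * fnorm x <= fnorm (A *m x).
  rewrite Ax -{1}Qx -mulmxA mulrC -ler_pdivlMr // mulrC.
  exact: (trunc_opboundW tA).
have h2 : fnorm (B *m x) <= s' k * fnorm x.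
  by rewrite Bx; exact: opbound_svd_residual hB k _ _.
have h3 : fnorm (A *m x) <= fnorm (A - B) * fnorm x + fnorm (B *m x).
  rewrite -[A in X in X <= _](subrK B) mulmxDl.
  by apply: le_trans (fnormD _ _) _; rewrite lerD2r fnormM.
by rewrite -(ler_pM2r x_gt0) mulrDl; lra.
Qed.

(** Weyl's inequality between two decompositions of the same matrix, in both directions. It makes
    the choice in [singular_values] canonical. *)
Lemma svd_unique l m (A : 'M[R]_(l, m)) U s V U' s' V' :
  is_svd A U s V -> is_svd A U' s' V' -> s = s'.
Proof.
move=> h h'; apply/funext => k; apply/le_anti.
have := svd_weyl k h h'; have := svd_weyl k h' h.
by rewrite subrr fnorm0 !addr0 => -> ->.
Qed.

(** A strict gap rules out the default value of [xget], the zero sequence, so the sequence selected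
    does come from a decomposition. *)
Lemma svd_of_gap l m r (A : 'M[R]_(l, m)) : sigma r.+1 A < sigma r A ->
  exists U V, is_svd A U (singular_values A) V.
Proof.
rewrite /sigma /singular_values; case: xgetP => [s sE //|_].
by rewrite ltxx.
Qed.

(** [xget] may pick the truncation of any SVD of [A]; its singular values are the canonical ones by
    [svd_unique], and [truncation_svd] holds for each SVD. The gap gives [sigma_r > 0]. *)
Lemma proj_fixed_rank_truncation l m r (A : 'M[R]_(l, m)) : (0 < r)%N ->
  sigma r.+1 A < sigma r A ->
  exists W, truncation r A (proj_fixed_rank r A) W (sigma r A) (sigma r.+1 A).
Proof.
move=> r0 gap; have [U [V svdA]] := svd_of_gap gap.
rewrite /proj_fixed_rank; case: xgetP => [B BE [U' [s [V' [h' ->]]]]|]; last first.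
  move/(_ (svd_trunc U (singular_values A) V r)); case.
  by exists U, (singular_values A), V.
have sE := svd_unique h' svdA; eexists.
rewrite /sigma -sE; apply: truncation_svd => //.
rewrite sE; apply: le_lt_trans gap; rewrite /sigma.
by case: svdA.
Qed.

(** The gaps provide decompositions of [A] and [B], to which Weyl's inequality applies both ways. *)
Lemma sigma_lipschitz l m r k (A B : 'M[R]_(l, m)) :
  sigma r.+1 A < sigma r A -> sigma r.+1 B < sigma r B ->
  `|sigma k A - sigma k B| <= fnorm (A - B).
Proof.
move=> /svd_of_gap[U [V h]] /svd_of_gap[U' [V' h']].
have := svd_weyl k.-1 h h'; have := svd_weyl k.-1 h' h.
rewrite (fnormB B) -!/(sigma k _) ler_norml; lra.
Qed.

End SingularValues.

(** * Pseudoinverses of matrices of given rank *)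

Section PseudoInverse.
Variable R : realType.

Lemma row_inj_unit n (G : 'M[R]_n) :
  (forall k (B : 'M[R]_(k, n)), B *m G = 0 -> B = 0) -> G \in unitmx.
Proof.
by move=> inj; rewrite -row_free_unit -kermx_eq0; apply/eqP/inj/mulmx_ker.
Qed.

(** [B C C^T = 0] gives [|B C|^2 = 0], and [D] then cancels [C]. *)
Lemma gram_unit n k (C : 'M[R]_(k, n)) (D : 'M[R]_(n, k)) :
  C *m D = 1%:M -> C *m C^T \in unitmx.
Proof.
move=> CD; apply: row_inj_unit => p B BG.
have : B *m C = 0.
  apply: fnorm_eq0; rewrite /fnorm fdot_mulmxr -mulmxA BG fdot0r.
  by rewrite sqrtr0.
by move/(congr1 (mulmx^~ D)); rewrite -mulmxA CD mulmx1 mul0mx.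
Qed.

(** For a full rank factorization [A = C D], take [D^T (D D^T)^-1 (C^T C)^-1 C^T]. This serves the
    points of the manifold for which a rank, but no SVD, is at hand. *)
Lemma pinv_exists l m (A : 'M[R]_(l, m)) : exists W, pinv (\rank A) A W.
Proof.
have [C CE] := row_fullP (col_base_full A).
have [D DE] := row_freeP (row_base_free A).
move: (col_base A) (row_base A) (mulmx_base A) C D CE DE.
move: (\rank A) => k cb rb <- C D CE DE.
have uC : cb^T *m cb \in unitmx.
  have := @gram_unit _ _ cb^T C^T; rewrite trmxK; apply.
  by rewrite -trmx_mul CE trmx1.
have uR : rb *m rb^T \in unitmx by exact: gram_unit DE.
pose H := invmx (cb^T *m cb); pose G := invmx (rb *m rb^T).
have HT : H^T = H by rewrite trmx_inv trmx_mul trmxK.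
have GT : G^T = G by rewrite trmx_inv trmx_mul trmxK.
have G1 : rb *m (rb^T *m G) = 1%:M by rewrite mulmxA mulmxV.
have H1 : H *m cb^T *m cb = 1%:M by rewrite -mulmxA mulVmx.
exists (rb^T *m G *m (H *m cb^T)).
have AW : cb *m rb *m (rb^T *m G *m (H *m cb^T)) = cb *m (H *m cb^T).
  by rewrite -(mulmxA cb) (mulmxA rb) G1 mul1mx.
have WA : rb^T *m G *m (H *m cb^T) *m (cb *m rb) = rb^T *m G *m rb.
  by rewrite -(mulmxA _ _ (cb *m rb)) (mulmxA (H *m _)) H1 mul1mx.
split.
- by rewrite AW -(mulmxA cb) (mulmxA (H *m _)) H1 mul1mx.
- by rewrite AW !trmx_mul trmxK HT mulmxA.
- by rewrite WA !trmx_mul trmxK GT !mulmxA.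
- by rewrite AW mxtrace_mulC H1 mxtrace1.
Qed.

(** A row kernel element satisfies [B = - s B M], which is impossible for [B != 0] once
    [|s| (1 + |M|) < 1]. *)
Lemma near0_unit n (M : 'M[R]_n) :
  \forall s \near (0 : R), 1%:M + s *: M \in unitmx.
Proof.
have c0 : 0 < (1 + fnorm M)^-1 by rewrite invr_gt0 ltr_wpDr ?fnorm_ge0.
near=> s; apply: row_inj_unit => k B.
rewrite mulmxDr mulmx1 => /eqP; rewrite addr_eq0 => /eqP BE.
have sM : `|s| * (1 + fnorm M) < 1.
  rewrite -ltr_pdivlMr ?ltr_wpDr ?fnorm_ge0 // mul1r.
  by near: s; exact: (@nbhs0_lt R R _ c0).
have B_le : fnorm B <= `|s| * (fnorm B * fnorm M).
  by rewrite {1}BE fnormN -scalemxAr fnormZ ler_wpM2l // fnormM.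
apply/fnorm_eq0/eqP/negPn/negP => B0.
have B_gt0 : 0 < fnorm B by rewrite lt_def B0 fnorm_ge0.
have : fnorm B * (`|s| * (1 + fnorm M)) < fnorm B * 1 by rewrite ltr_pM2l.
rewrite mulr1 mulrDr mulr1 mulrDr => h.
have := mulr_ge0 (fnorm_ge0 B) (normr_ge0 s); lra.
Unshelve. all: by end_near.
Qed.

End PseudoInverse.

(** * Derivatives measured in the Frobenius norm *)

Section Derivative.
Variable R : realType.

(** A crude constant suffices to transfer limits from the max norm; the successor keeps it positive
    for empty matrices. *)
Lemma fnorm_le_norm l m (A : 'M[R]_(l, m)) : fnorm A <= (l * m).+1%:R * `|A|.
Proof.
have entry i j : `|A i j| <= `|A|.
  rewrite [leRHS]/Num.norm /= mx_normrE.
  exact: (le_bigmax _ (fun ij : 'I_l * 'I_m => `|A ij.1 ij.2|) (i, j)).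
apply: ler_fnormP; first by rewrite mulr_ge0.
rewrite fdotE exprMn.
apply: (@le_trans _ _ (\sum_(i < l) \sum_(j < m) `|A| ^+ 2)).
  apply: ler_sum => i _; apply: ler_sum => j _.
  by rewrite -expr2 -[leLHS]real_normK ?num_real // ler_pXn2r ?nnegrE.
rewrite !sumr_const !card_ord -mulrnA -[leLHS]mulr_natl mulnC ler_wpM2r ?sqr_ge0 //.
by rewrite -natrX ler_nat (leq_trans (leqnSn _)) // -mulnn leq_pmulr.
Qed.

Lemma cvg_fnorm l m (F : set_system R) {FF : Filter F}
    (f : R -> 'M[R]_(l, m)) (v : 'M[R]_(l, m)) :
  f s @[s --> F] --> v -> forall e : R, 0 < e -> \forall s \near F, fnorm (f s - v) <= e.
Proof.
move=> fv e e0; have c0 : 0 < (l * m).+1%:R :> R by rewrite ltr0n.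
have := @cvgr_distC_le _ _ _ F FF f v fv (e / (l * m).+1%:R).
rewrite divr_gt0 // => /(_ isT); apply: filterS => s h.
by apply: le_trans (fnorm_le_norm _) _; rewrite mulrC -ler_pdivlMr.
Qed.

Lemma fnorm_difference_quotient l m (f0 f1 v : 'M[R]_(l, m)) h e : h != 0 ->
  fnorm (h^-1 *: (f1 - f0) - v) <= e -> fnorm (f1 - f0 - h *: v) <= e * `|h|.
Proof.
move=> h0 le_e; rewrite mulrC -[f1 - f0]scale1r -(divff h0) -scalerA -scalerBr.
by rewrite fnormZ ler_wpM2l.
Qed.

Lemma has_derivative_within_fnorm l m (D : set R) (f : R -> 'M[R]_(l, m)) t v :
  has_derivative_within D f t v -> forall e, 0 < e ->
  exists2 d, 0 < d & forall s, D s -> `|s - t| < d ->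
    fnorm (f s - f t - (s - t) *: v) <= e * `|s - t|.
Proof.
move=> fv e e0.
have /nbhs_ballP[d /= d0 hd] : nbhs t (fun s => (D `\ t) s ->
  fnorm ((s - t)^-1 *: (f s - f t) - v) <= e) by exact: cvg_fnorm fv _ e0.
exists d => // s Ds st.
have [->|st0] := eqVneq s t.
  by rewrite !subrr scale0r subrr fnorm0 normr0 mulr0.
apply: fnorm_difference_quotient; first by rewrite subr_eq0.
apply: hd; first by rewrite /ball /= distrC.
by split=> // /= e1; rewrite e1 eqxx in st0.
Qed.

Lemma derivable_fnorm l m (g : R -> 'M[R]_(l, m)) : derivable g 0 1 ->
  forall e, 0 < e ->
  exists2 d, 0 < d & forall s, `|s| < d ->
    fnorm (g s - g 0 - s *: derive1 g 0) <= e * `|s|.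
Proof.
move=> dg e e0.
have hg : h^-1 *: (g h - g 0) @[h --> 0^'] --> derive1 g 0.
  rewrite derive1E; apply: cvg_trans dg; apply: near_eq_cvg; near=> h.
  by rewrite /= scaler1 addr0.
have /nbhs_ballP[d /= d0 hd] : nbhs (0 : R) (fun s => s != 0 ->
  fnorm (s^-1 *: (g s - g 0) - derive1 g 0) <= e) by exact: cvg_fnorm hg _ e0.
exists d => // s sd.
have [->|s0] := eqVneq s 0.
  by rewrite subrr scale0r subrr fnorm0 normr0 mulr0.
apply: fnorm_difference_quotient => //.
by apply: hd => //; rewrite /ball /= sub0r normrN.
Unshelve. all: by end_near.
Qed.

Lemma quadratic_curve_derivative l m (A B C : 'M[R]_(l, m)) (s : R) :
  let g u := A + u *: B + u ^+ 2 *: C in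
  derivable g s 1 /\ derive1 g s = B + (2 * s) *: C.
Proof.
move=> g.
have hg : h^-1 *: (g (h *: 1 + s) - g s) @[h --> (0 : R)^'] --> B + (2 * s) *: C.
  apply: (@cvg_trans _ ((B + (2 * s + h) *: C) @[h --> (0 : R)^'])).
    apply: near_eq_cvg; near=> h.
    have h0 : h != 0 by near: h; exact: nbhs_dnbhs_neq.
    rewrite /g scaler1; apply/matrixP => i j; rewrite !mxE; field.
    exact: h0.
  apply: cvgD; first exact: cvg_cst.
  apply: cvgZr_tmp; rewrite -[X in _ --> X]addr0; apply: cvgD; first exact: cvg_cst.
  exact: nbhs_dnbhs.
split; first by apply/cvg_ex; exists (B + (2 * s) *: C).
by rewrite derive1E; apply: cvg_lim hg => //; exact: norm_hausdorff.
Unshelve. all: by end_near.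
Qed.

End Derivative.

(** * Tangent space of the fixed rank manifold *)

Section TangentSpace.
Variables (R : realType) (l m r : nat) (A : 'M[R]_(l, m)) (W : 'M[R]_(m, l)).
Hypotheses (rA : \rank A = r) (pA : pinv r A W).

(** Along a curve of constant rank, the normal part of [g s] at [A] is quadratic in [g s - A], hence
    [O(s^2)], so the velocity has no normal part. Conversely an explicit quadratic curve realizes
    [X]. *)
Lemma tangent_spaceP X : tangent_space r A X <-> normal_part A W X = 0.
Proof.
split=> [[g [rg dg g0 dg0]]|NX].
  have [dg00 _] := nbhs_singleton dg.
  apply/fnorm_eq0/le_anti; rewrite fnorm_ge0 andbT.
  apply/ler_addgt0Pl => e e0; rewrite addr0.
  (* [c * s^2] will bound the normal part of [g s], through [|g s - A| <= (|X| + 1) |s|]. *)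
  pose w := fnorm W; pose c := w * (fnorm X + 1) ^+ 2.
  have w0 : 0 <= w := fnorm_ge0 _.
  have c0 : 0 <= c by rewrite mulr_ge0 ?sqr_ge0.
  have e2 : 0 < e / 2 by rewrite divr_gt0.
  have [d1 d10 hd1] := derivable_fnorm dg00 e2.
  have [d2 d20 hd2] := derivable_fnorm dg00 (ltr01 : 0 < 1 :> R).
  have near_s : \forall s \near (0 : R)^', [/\ \rank (g s) = r, `|s| < d1, `|s| < d2,
      c * `|s| <= e / 2 & s != 0].
    near=> s; split.
    - by near: s; apply: nbhs_dnbhs; exact: rg.
    - by near: s; exact: dnbhs0_lt.
    - by near: s; exact: dnbhs0_lt.
    - have : `|s| <= e / 2 / (c + 1).
        by near: s; apply: dnbhs0_le; rewrite divr_gt0 // ltr_wpDl.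
      rewrite ler_pdivlMr ?ltr_wpDl // => h.
      by have := normr_ge0 s; lra.
    - by near: s; exact: nbhs_dnbhs_neq.
  have [s [rs s1 s2 cs s0]] := @filter_ex _ _ (Proper_dnbhs_numFieldType 0) _ near_s.
  have [V pV] := pinv_exists (g s); rewrite rs in pV.
  have b1 := hd1 _ s1; have b2 := hd2 _ s2; rewrite mul1r dg0 g0 in b1 b2.
  have b3 : fnorm (g s - A) <= (fnorm X + 1) * `|s|.
    rewrite -[g s - A](subrK (s *: X)); apply: le_trans (fnormD _ _) _.
    by rewrite mulrDl mul1r (fnormZ s) mulrC addrC lerD2l.
  have b4 := fnorm_normal_part_rank pA pV w0 (@opbound_fnorm _ _ _ W).
  have b5 : s *: normal_part A W X =
      normal_part A W (g s) - normal_part A W (g s - A - s *: X).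
    rewrite !normal_partB normal_partZ (normal_part_id pA) subr0.
    by rewrite opprB addrC subrK.
  have b6 : `|s| * fnorm (normal_part A W X) <= c * `|s| ^+ 2 + e / 2 * `|s|.
    rewrite -fnormZ b5; apply: le_trans (fnormD _ _) _; rewrite fnormN.
    apply: lerD; last exact: le_trans (fnorm_normal_part _ pA) b1.
    apply: le_trans b4 _; rewrite /c -mulrA -exprMn ler_wpM2l //.
    by rewrite ler_pXn2r ?nnegrE ?fnorm_ge0 ?mulr_ge0 ?addr_ge0 ?fnorm_ge0.
  have s_gt0 : 0 < `|s| by rewrite normr_gt0.
  have : `|s| * fnorm (normal_part A W X) <= `|s| * e.
    have := ler_wpM2r (normr_ge0 s) cs; lra.
  by rewrite ler_pM2l.
(* [M A = (1 - P) X Q] and [A N = P X], with [P = A W] and [Q = W A], add up to [X] minus its normal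
   part. The outer factors of [g] are invertible near [0], so the rank is kept. *)
pose M := (1%:M - A *m W) *m X *m W; pose N := W *m X.
pose g (s : R) := (1%:M + s *: M) *m A *m (1%:M + s *: N).
have XE : M *m A + A *m N = X.
  have : X - normal_part A W X = M *m A + A *m N.
    rewrite /normal_part /M /N (mulmxBr _ 1%:M) mulmx1 opprB -(mulmxA _ W A) (mulmxA A W X).
    move: (_ *m (W *m A)) => Y; rewrite (mulmxBl 1%:M) mul1mx.
    by move: (A *m W *m X) => Z; apply/matrixP => i j; rewrite !mxE; ring.
  by rewrite NX subr0.
have gE : g = fun s => A + s *: X + s ^+ 2 *: (M *m A *m N).
  apply/funext => s; rewrite /g mulmxDl mul1mx mulmxDr mulmx1 mulmxDl.
  rewrite -!scalemxAl -!scalemxAr scalerA -expr2 -XE scalerDr.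
  by rewrite !addrA; congr (_ + _); rewrite -!addrA; congr (_ + _); rewrite addrC.
have dg s := quadratic_curve_derivative A X (M *m A *m N) s.
exists g; split.
- near=> s; rewrite /fixed_rank /= /g mxrankMfree; last first.
    by rewrite row_free_unit; near: s; exact: near0_unit.
  rewrite -mxrank_tr trmx_mul mxrankMfree ?mxrank_tr // row_free_unit unitmx_tr.
  by near: s; exact: near0_unit.
- near=> s; rewrite gE; split; first exact: (dg s).1.
  rewrite (_ : derive1 _ = fun u => X + (2 * u) *: (M *m A *m N)); last first.
    by apply/funext => u; exact: (dg u).2.
  apply: cvgD; first exact: cvg_cst.
  by apply: cvgZr_tmp; apply: cvgM; [exact: cvg_cst|exact: cvg_id].
- by rewrite /g !scale0r !addr0 mul1mx mulmx1.
- by rewrite gE (dg 0).2 mulr0 scale0r addr0.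
Unshelve. all: by end_near.
Qed.

(** The difference of two candidates is both tangent and orthogonal to the tangent space, hence
    zero; this pins down the choice of [xget]. *)
Lemma orth_proj_tangent_space X :
  orth_proj (tangent_space r A) X = X - normal_part A W X.
Proof.
have tP : normal_part A W (X - normal_part A W X) = 0.
  by rewrite normal_partB (normal_part_idem _ pA) subrr.
apply: xget_unique.
  split; first exact/tangent_spaceP.
  move=> Z /tangent_spaceP NZ.
  by rewrite opprB addrC subrK (normal_part_sym _ _ pA) NZ fdot0r.
move=> Y [/tangent_spaceP NY oY].
have NV : normal_part A W (X - normal_part A W X - Y) = 0.
  by rewrite normal_partB tP NY subr0.
apply/eqP; rewrite eq_sym -subr_eq0; apply/eqP/fnorm_eq0.
move: NV oY; set V := X - _ - Y => NV oY.
rewrite /fnorm {1}/V addrAC fdotBl oY; last exact/tangent_spaceP.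
by rewrite (normal_part_sym _ _ pA) NV fdot0r subrr sqrtr0.
Qed.

End TangentSpace.

(** * Integration of a Dini derivative bound *)

Section DiniDerivative.
Variable R : realType.
Notation mu := (@lebesgue_measure R).

(** A bound on the upper right Dini derivative, the limsup of [(w (s + h) - w s) / h], cleared of
    its denominator. *)
Definition dini_le (w : R -> R) (s c : R) := forall e, 0 < e ->
  exists2 d, 0 < d & forall h, 0 < h -> h < d -> w (s + h) <= w s + h * (c + e).

(** Let [c] be the last point of [[a, b]] where [w] lies below the line of slope [C + e] from [a].
    Continuity puts [c] itself in this set, and the Dini bound at [c] would extend it to the right
    if [c < b]. *)
Lemma dini_le_lipschitz (w : R -> R) (t C : R) : continuous w ->
  (forall s, 0 <= s < t -> dini_le w s C) ->
  forall a b, 0 <= a -> a <= b -> b <= t -> w b <= w a + C * (b - a).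
Proof.
move=> cw dw a b a0 ab bt; apply/ler_addgt0Pl => e' e'0.
(* The excess slope [e] costs at most [e'] over [[a, b]]; the [+ 1] covers [a = b]. *)
pose e := e' / (b - a + 1).
have ba1 : 0 < b - a + 1 by rewrite ltr_wpDl // subr_ge0.
have e0 : 0 < e by rewrite divr_gt0.
have ee' : e * (b - a) <= e'.
  rewrite /e mulrAC ler_pdivrMr // ler_pM2l //; lra.
pose phi u := w u - w a - (C + e) * (u - a).
suff : phi b <= 0 by rewrite /phi; lra.
rewrite leNgt; apply/negP => phib.
pose E := [set u | a <= u <= b /\ phi u <= 0].
have Ea : E a by split; [rewrite lexx ab|rewrite /phi !subrr mulr0 subr0].
have Eb : ubound E b by move=> u [/andP[]].
have supE : has_sup E by split; [exists a|exists b].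
have cphi : continuous phi.
  move=> u; apply: cvgB; first by apply: cvgB; [exact: cw|exact: cvg_cst].
  by apply: cvgM; [exact: cvg_cst|apply: cvgB; [exact: cvg_id|exact: cvg_cst]].
pose c := sup E.
have ac : a <= c by exact: (ub_le_sup (proj2 supE)).
have cb : c <= b by apply: (ge_sup (proj1 supE)).
have phic : phi c <= 0.
  rewrite leNgt; apply/negP => phic.
  have /nbhs_ballP[d /= d0 hd] : nbhs c (fun u => `|phi c - phi u| < phi c).
    by move/cvgrPdist_lt : (cphi c) => /(_ _ phic).
  have [u [/andP[au ub] phiu] cu] := sup_adherent d0 supE.
  have uc : u <= c by apply: (ub_le_sup (proj2 supE)); split => //; rewrite au.
  have /hd : ball c d u by rewrite /ball /= ger0_norm ?subr_ge0 //; rewrite -/c in cu; lra.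
  by rewrite ltr_norml; lra.
have {}cb : c < b.
  by rewrite lt_neqAle cb andbT; apply: contraTneq phic => ->; rewrite -ltNge.
have c_itv : 0 <= c < t by rewrite (le_trans a0 ac) (lt_le_trans cb bt).
have [d d0 hd] := dw c c_itv e e0.
pose h := Num.min (d / 2) (b - c).
have h0 : 0 < h by rewrite lt_min divr_gt0 //= subr_gt0.
have hd2 : h <= d / 2 by rewrite ge_min lexx.
have hbc : h <= b - c by rewrite ge_min lexx orbT.
have : c + h <= c.
  apply: (ub_le_sup (proj2 supE)); split; first by apply/andP; split; lra.
  have : h < d by lra.
  by move=> /(hd h h0); rewrite /phi in phic *; lra.
lra.
Qed.

Lemma integrable_bounded_itv (f : R -> R) (a b C : R) : measurable_fun `[a, b] f ->
  (forall x, x \in `[a, b] -> `|f x| <= C) -> mu.-integrable `[a, b] (EFin \o f).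
Proof.
move=> mf fC; apply: measurable_bounded_integrable => //.
  by apply: compact_finite_measure; exact: segment_compact.
exists C; split; first exact: num_real.
by move=> M CM x xab; apply: le_trans (ltW CM); exact: fC.
Qed.

Lemma continuous_shift (w : R -> R) (c : R) :
  continuous w -> continuous (fun s => w (s + c)).
Proof.
move=> cw s; apply: (@continuous_comp _ _ _ (fun s => s + c) w); last exact: cw.
by apply: cvgD; [exact: cvg_id|exact: cvg_cst].
Qed.

(** If [V] is a primitive of [w], the difference quotient of [V] is a primitive of that of [w]. The
    integral is thus a difference of two quotients of [V], tending to [w t] and [w 0]. [V] starts at
    [-1] so that [[0, t]] is interior to its domain. *)
Lemma diff_quotient_integral (w : R -> R) (t : R) : continuous w -> 0 < t ->
  \int[mu]_(s in `[0, t]) (n.+1%:R * (w (s + n.+1%:R^-1) - w s)) @[n --> \oo]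
    --> w t - w 0.
Proof.
move=> cw t0; pose V y := \int[mu]_(s in `[-1, y]) w s.
have dV (x : R) : -1 < x -> derivable V x 1 /\ derive1 V x = w x.
  move=> x1; apply: (@continuous_FTC1 _ w (BLeft (-1)) x (x + 1)).
  - by rewrite ltrDl.
  - apply: continuous_compact_integrable; first exact: segment_compact.
    exact: continuous_subspaceT.
  - by rewrite lte_fin.
  - exact: cw.
have quot (x : R) : -1 < x -> n.+1%:R * (V (x + n.+1%:R^-1) - V x) @[n --> \oo] --> w x.
  move=> x1; have [dVx wE] := dV x x1.
  have hV : h^-1 *: (V (h + x) - V x) @[h --> (0 : R)^'] --> w x.
    rewrite -wE derive1E; apply: cvg_trans dVx; apply: near_eq_cvg; near=> h.
    by rewrite /= scaler1.
  rewrite (_ : (fun n => _) =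
      (fun n : nat => n.+1%:R^-1^-1 *: (V (n.+1%:R^-1 + x) - V x))); last first.
    by apply/funext => n; rewrite invrK (addrC x).
  apply: ((cvgr_dnbhsP _ _ _).1 hV (fun n => n.+1%:R^-1)).
  split; last exact: cvg_harmonic.
  by move=> n; rewrite invr_eq0 pnatr_eq0.
have FTC n : \int[mu]_(s in `[0, t]) (n.+1%:R * (w (s + n.+1%:R^-1) - w s)) =
    n.+1%:R * (V (t + n.+1%:R^-1) - V t) - n.+1%:R * (V (0 + n.+1%:R^-1) - V 0).
  pose h : R := n.+1%:R^-1; pose G s := n.+1%:R * (V (s + h) - V s).
  have h0 : 0 <= h by rewrite invr_ge0.
  have dG (s : R) : -1 < s -> is_derive s (1 : R) G (n.+1%:R * (w (s + h) - w s)).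
    move=> s1; have sh1 : -1 < s + h by rewrite ltr_wpDr.
    have [d1 e1] := dV _ s1; have [d2 e2] := dV _ sh1.
    have i1 : is_derive s (1 : R) V (w s).
      exact: (DeriveDef d1 (etrans (esym (derive1E V s)) e1)).
    have i2 : is_derive (s + h) (1 : R) V (w (s + h)).
      exact: (DeriveDef d2 (etrans (esym (derive1E V (s + h))) e2)).
    have i3 : is_derive s (1 : R) (fun s => V (s + h)) (w (s + h)).
      rewrite -[w (s + h)]mulr1.
      apply: (@is_derive1_comp _ V (fun s => s + h)).
      rewrite -[X in is_derive _ _ _ X]addr0.
      exact: is_deriveD.
    exact: is_deriveZ.
  rewrite /Rintegral (continuous_FTC2 (F := G)) //=.
  - apply: continuous_subspaceT => s; apply: cvgM; first exact: cvg_cst.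
    apply: cvgB; last exact: cw.
    exact: (@continuous_shift w n.+1%:R^-1 cw s).
  - have cG s : -1 < s -> {for s, continuous G}.
      by move=> /dG dGs; apply/differentiable_continuous/derivable1_diffP.
    split.
    + by move=> s /[!in_itv] /= /andP[s0 _]; case: (dG s _) => //; lra.
    + by apply: cvg_at_right_filter; apply: cG; lra.
    + by apply: cvg_at_left_filter; apply: cG; lra.
  - move=> s /[!in_itv] /= /andP[s0 _]; rewrite derive1E.
    by case: (dG s _) => //; lra.
under eq_cvg do rewrite FTC.
by apply: cvgB; apply: quot; lra.
Unshelve. all: by end_near.
Qed.

(** The quotient [D n] is at most [g + f n], where [f n] is the positive part of [D n - g]. The Dini
    bound sends [f n] to [0] pointwise and the Lipschitz bound [C] dominates it, while the integral
    of [D n] tends to [w t - w 0]. Freezing [w] after [t] handles quotients that reach beyond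
    [t]. *)
Lemma dini_le_integral (w g : R -> R) (t C : R) : continuous w -> 0 < t ->
  (forall s, t <= s -> w s = w t) ->
  measurable_fun `[0, t] g ->
  (forall s, s \in `[0, t] -> 0 <= g s <= C) ->
  (forall s, 0 <= s < t -> dini_le w s (g s)) ->
  w t - w 0 <= \int[mu]_(s in `[0, t]) g s.
Proof.
move=> cw t0 w_t mg gC dw.
have C0 : 0 <= C.
  have /andP[] : 0 <= g 0 <= C by apply: gC; rewrite in_itv /= lexx ltW.
  exact: le_trans.
have lipw a b : 0 <= a -> a <= b -> w b - w a <= C * (b - a).
  move=> a0 ab.
  have lip0 := @dini_le_lipschitz w t C cw.
  have {lip0} lip0 : forall a b, 0 <= a -> a <= b -> b <= t -> w b <= w a + C * (b - a).
    apply: lip0 => s st e e0; have [d d0 hd] := dw s st e e0; exists d => // h h0 h_d.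
    apply: le_trans (hd h h0 h_d) _; rewrite lerD2l ler_wpM2l ?(ltW h0) // lerD2r.
    have /andP[//] : 0 <= g s <= C.
    by apply: gC; rewrite in_itv /=; case/andP: st => -> /ltW ->.
  have [bt|tb] := leP b t; first by have := lip0 a b a0 ab bt; lra.
  have [at_|ta] := leP a t; last by rewrite !w_t ?(ltW ta) ?(ltW tb) // subrr mulr_ge0 // subr_ge0.
  rewrite (w_t b (ltW tb)); have := lip0 a t a0 at_ (lexx t).
  have : C * (t - a) <= C * (b - a) by rewrite ler_wpM2l // lerD2r ltW.
  lra.
pose D n s := n.+1%:R * (w (s + n.+1%:R^-1) - w s).
have cD n : continuous (D n).
  move=> s; apply: cvgM; first exact: cvg_cst.
  apply: cvgB; last exact: cw.
  exact: (@continuous_shift w n.+1%:R^-1 cw s).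
have mD n : measurable_fun `[0, t] (D n).
  apply: (@measurable_funS _ _ _ _ setT) => //.
  exact: continuous_measurable_fun.
have DC n s : 0 <= s -> D n s <= C.
  move=> s0; rewrite /D -ler_pdivlMl ?ltr0n // mulrC.
  apply: le_trans (lipw _ _ s0 _) _; first by rewrite lerDl invr_ge0.
  by rewrite addrAC subrr add0r.
pose f n s := Num.max (D n s - g s) 0.
have mf n : measurable_fun `[0, t] (f n).
  by apply: measurable_maxr => //; exact: measurable_funB.
have fC n s : s \in `[0, t] -> `|f n s| <= C.
  move=> st; have /andP[g0 _] := gC s st.
  have s0 : 0 <= s by move: st; rewrite in_itv => /andP[].
  rewrite ger0_norm /f; last by rewrite le_max lexx orbT.
  by rewrite ge_max C0 andbT; have := DC n s s0; lra.
have f0 s : s \in `[0, t] -> f n s @[n --> \oo] --> 0.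
  move=> st; have /andP[g0 _] := gC s st.
  have [s0 s_t] : 0 <= s /\ s <= t by move: st; rewrite in_itv => /andP.
  apply/cvgrPdist_le => e e0.
  (* At [s = t] there is no Dini bound, but the quotients vanish because [w] is constant from there
     on. *)
  have [st'|ts] := ltP s t; last first.
    near=> n; rewrite sub0r normrN /f /D !w_t ?(le_trans ts) ?lerDl ?invr_ge0 //.
    by rewrite subrr mulr0 sub0r (max_idPr _) ?oppr_le0 // normr0 ltW.
  have [|d d0 hd] := dw s _ e e0; first by rewrite s0.
  have : \forall n \near \oo, n.+1%:R^-1 < d.
    have /cvgrPdist_lt/(_ d d0) := @cvg_harmonic R; apply: filterS => n.
    by rewrite sub0r normrN ger0_norm // invr_ge0.
  apply: filterS => n nd; rewrite sub0r normrN ger0_norm /f; last by rewrite le_max lexx orbT.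
  rewrite ge_max (ltW e0) andbT lerBlDr /D -ler_pdivlMl ?ltr0n //.
  have := hd n.+1%:R^-1 _ nd; rewrite invr_gt0 ltr0n => /(_ isT).
  by rewrite lerBlDl (addrC e).
have iC : mu.-integrable `[0, t] (EFin \o (fun=> C)).
  apply: (@integrable_bounded_itv _ _ _ C) => [|s _]; first exact: measurable_cst.
  by rewrite ger0_norm.
have ig : mu.-integrable `[0, t] (EFin \o g).
  apply: integrable_bounded_itv mg (_ : forall s, _ -> _ <= C) => s st.
  by have /andP[g0 ?] := gC s st; rewrite ger0_norm.
have if_ n : mu.-integrable `[0, t] (EFin \o f n).
  exact: integrable_bounded_itv (mf n) (fC n).
have iD n : mu.-integrable `[0, t] (EFin \o D n).
  apply: continuous_compact_integrable; first exact: segment_compact.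
  exact: continuous_subspaceT.
have intf : \int[mu]_(s in `[0, t]) f n s @[n --> \oo] --> 0.
  have f0E s : s \in `[0, t] -> (f n s)%:E @[n --> \oo] --> 0%E.
    by move=> st; apply: cvg_EFin; [exact: nearW|exact: f0 st].
  have [] := @dominated_convergence _ _ _ mu `[0, t] (measurable_itv _)
    (fun n s => (f n s)%:E) (cst 0%E) (EFin \o (fun=> C)).
  - by move=> n; apply/measurable_EFinP; exact: mf.
  - exact: measurable_cst.
  - by apply: aeW => s st; exact: f0E.
  - exact: iC.
  - by apply: aeW => s n st; rewrite /= lee_fin; exact: fC.
  move=> _ _ h.
  by apply: fine_cvg; rewrite integral0 in h.
have := diff_quotient_integral cw t0.
have intgf : \int[mu]_(s in `[0, t]) g s + \int[mu]_(s in `[0, t]) f n s @[n --> \oo]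
    --> \int[mu]_(s in `[0, t]) g s.
  by rewrite -[X in _ --> X]addr0; apply: cvgD => //; exact: cvg_cst.
move=> h; apply: ler_cvg_to h intgf _; near=> n.
rewrite -RintegralD //; apply: le_Rintegral => //.
- exact: iD.
- rewrite (_ : EFin \o _ = (EFin \o g) \+ (EFin \o f n))%E; last first.
    by apply/funext => s; rewrite /= EFinD.
  exact: integrableD.
- by move=> s _; rewrite -lerBlDl /f le_max lexx.
Unshelve. all: by end_near.
Qed.

End DiniDerivative.

(** * Growth of the error over a short time step *)

Section ErrorGrowth.
Variable R : realType.

(** Compare squares: with [u] the total increment, [(d + u)^2 >= d^2 + 2 d u], and the last term of
    [u] is tuned so that [2 d u = 2 h k d + h^2 v^2]. *)
Lemma fnorm_addZ_le l m (D V : 'M[R]_(l, m)) k h : D != 0 -> 0 <= h ->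
  fdot D V <= k * fnorm D ->
  fnorm (D + h *: V) <= fnorm D + h * k + h ^+ 2 * (fnorm V ^+ 2 / (2 * fnorm D)).
Proof.
move=> D0 h0 DV.
have d0 : 0 < fnorm D.
  by rewrite lt_def fnorm_ge0 andbT; apply: contra D0 => /eqP/fnorm_eq0/eqP.
set d := fnorm D in DV d0 *; set v := fnorm V.
have E : fdot (D + h *: V) (D + h *: V) = d ^+ 2 + 2 * h * fdot D V + h ^+ 2 * v ^+ 2.
  by rewrite !sqr_fnorm fdotDl !fdotDr !fdotZl !fdotZr (fdotC V D); ring.
have E0 : 0 <= d ^+ 2 + 2 * (h * (k * d)) + h ^+ 2 * v ^+ 2.
  apply: le_trans (fdot_ge0 (D + h *: V)) _; rewrite E lerD2r lerD2l -mulrA.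
  by rewrite ler_wpM2l // ler_wpM2l.
set u := h * k + h ^+ 2 * (v ^+ 2 / (2 * d)).
have du : d * u = h * (k * d) + h ^+ 2 * v ^+ 2 / 2.
  by rewrite /u; field; rewrite gt_eqF.
(* [k] may be negative; the sign comes from [E0], whose right-hand side dominates a squared norm. *)
have c0 : 0 <= d + u.
  rewrite -(pmulr_rge0 _ d0) mulrDr du -expr2.
  by have := sqr_ge0 d; lra.
rewrite -addrA -/u; apply: ler_fnormP => //; rewrite E sqrrD.
have hDV : h * fdot D V <= h * (k * d) by rewrite ler_wpM2l.
by have := sqr_ge0 u; rewrite mulr2n -mulrA du; lra.
Qed.

(* [U] is the velocity of the DO solution [Y], and [V] that of the truncation
   [Z] up to the discrepancy bounded by [truncation_expansion]. *)
Lemma fnorm_velocity_le l m r (A Z Y F G : 'M[R]_(l, m)) W a b K h :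
  truncation r A Z W a b -> \rank Y = r -> 0 <= K -> 0 <= h ->
  fnorm (G - F) <= K * fnorm (Y - A) ->
  forall U V, U = orth_proj (tangent_space r Y) G -> V = F - normal_part Z W F ->
  fnorm (Y - Z + h *: (U - V)) <= fnorm (Y - Z) +
    h * (K * (fnorm (Y - Z) + fnorm (A - Z)) + 2 / a * fnorm F * fnorm (Y - Z)) +
    h ^+ 2 * (fnorm (U - V) ^+ 2 / (2 * fnorm (Y - Z))).
Proof.
move=> tA rY K0 h0 GF U V UE VE; have pZ := trunc_pinv tA.
have a0 := trunc_a tA; have ai0 : 0 <= a^-1 by rewrite invr_ge0 ltW.
have YA : fnorm (Y - A) <= fnorm (Y - Z) + fnorm (A - Z).
  by rewrite (fnormB A); exact: fnorm_triB.
have GF' : fnorm (G - F) <= K * (fnorm (Y - Z) + fnorm (A - Z)).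
  by apply: le_trans GF _; rewrite ler_wpM2l.
(* When [Y = Z] the two tangent projectors coincide, and the quotient by [fnorm (Y - Z)] is [0]
   since [0^-1 = 0]. *)
have [YZ|YZ] := eqVneq Y Z.
  have pY : pinv r Y W by rewrite YZ.
  have UV : U - V = (G - F) - normal_part Z W (G - F).
    rewrite UE VE (orth_proj_tangent_space rY pY) YZ normal_partB.
    by apply/matrixP => i j; rewrite !mxE; ring.
  have uv := fnorm_tangent_part (G - F) pZ; rewrite -UV in uv.
  rewrite YZ subrr fnorm0 in GF' *.
  rewrite !add0r !mulr0 invr0 mulr0 mulr0 !addr0 fnormZ (ger0_norm h0).
  rewrite ler_wpM2l //; apply: le_trans uv _.
  by rewrite add0r in GF'.
apply: fnorm_addZ_le => //; first by rewrite subr_eq0.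
have [S] := pinv_exists Y; rewrite rY => pY.
(* The Lipschitz increment [G - F] is projected at [Y]; the rest is the change of projector acting
   on [F]. *)
have UV : U - V = ((G - F) - normal_part Y S (G - F)) -
    (normal_part Y S F - normal_part Z W F).
  rewrite UE VE (orth_proj_tangent_space rY pY) (normal_partB _ _ G).
  by apply/matrixP => i j; rewrite !mxE; ring.
have e1 : fdot (Y - Z) (G - F - normal_part Y S (G - F)) <=
    fnorm (Y - Z) * (K * (fnorm (Y - Z) + fnorm (A - Z))).
  apply: le_trans (fdot_le _ _) _; rewrite ler_wpM2l ?fnorm_ge0 //.
  exact: le_trans (fnorm_tangent_part _ pY) GF'.
(* Each normal projector is self-adjoint and kills its own base point, so the other matrix alone
   remains. *)
have e2 : fdot (Y - Z) (normal_part Y S F) = - fdot (normal_part Y S Z) F.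
  by rewrite -(normal_part_sym _ _ pY) normal_partB (normal_part_id pY) sub0r fdotNl.
have e3 : fdot (Y - Z) (normal_part Z W F) = fdot (normal_part Z W Y) F.
  by rewrite -(normal_part_sym _ _ pZ) normal_partB (normal_part_id pZ) subr0.
have e4 : fdot (normal_part Y S Z) F <= a^-1 * fnorm (Y - Z) ^+ 2 * fnorm F.
  apply: le_trans (fdot_le _ _) _; rewrite ler_wpM2r ?fnorm_ge0 //.
  exact: fnorm_normal_part_le pZ pY ai0 (trunc_opboundW tA).
have e5 : fdot (normal_part Z W Y) F <= a^-1 * fnorm (Y - Z) ^+ 2 * fnorm F.
  apply: le_trans (fdot_le _ _) _; rewrite ler_wpM2r ?fnorm_ge0 //.
  exact: fnorm_normal_part_rank pZ pY ai0 (trunc_opboundW tA).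
rewrite UV fdotBr (fdotBr _ (normal_part Y S F)) e2 e3.
by move: e1 e4 e5; rewrite expr2; lra.
Qed.

(* How far [a] and [b] may move while [b' / a] and [b / a'] stay below
   [rho / (1 + rho)], which tends to [b / a] as [x] tends to [0]. *)
Definition gap_slack (a b x : R) := let rho := b / (a - b) + x in
  rho / (1 + rho) * a - b.

Lemma gap_slack_gt0 a b x : 0 <= b -> b < a -> 0 < x -> 0 < gap_slack a b x.
Proof.
move=> b0 ba x0; rewrite /gap_slack; set rho := _ + x.
have ab : 0 < a - b by rewrite subr_gt0.
have r0 : 0 < rho by rewrite ltr_wpDl // divr_ge0 // ltW.
have -> : rho / (1 + rho) * a - b = (rho * (a - b) - b) / (1 + rho).
  by field; rewrite gt_eqF // addr_gt0.
apply: divr_gt0; last by rewrite addr_gt0.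
by rewrite /rho mulrDl divfK ?gt_eqF // addrAC subrr add0r mulr_gt0.
Qed.

(** Within [gap_slack], both ratios of [truncation_lipschitz] stay below [q = rho / (1 + rho)], and
    [1 - q = (1 + rho)^-1]. The constant [1 + rho] tends to [a / (a - b)] with [x]. *)
Lemma truncation_near l m r (A A' Z Z' : 'M[R]_(l, m)) W W' a b a' b' x :
  truncation r A Z W a b -> truncation r A' Z' W' a' b' ->
  b < a -> 0 < x -> `|a - a'| <= fnorm (A - A') -> `|b - b'| <= fnorm (A - A') ->
  fnorm (A' - A) <= gap_slack a b x ->
  forall rho, rho = b / (a - b) + x ->
  b' <= rho / (1 + rho) * a /\ fnorm (Z' - Z) <= (1 + rho) * fnorm (A' - A).
Proof.
move=> h h' ba x0; rewrite (fnormB A A') !ler_norml => /andP[_ a1] /andP[b1 _].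
move=> hE rho rhoE; rewrite /gap_slack -rhoE in hE.
have r0 : 0 < rho by rewrite rhoE ltr_wpDl // divr_ge0 ?(trunc_b h) // subr_ge0 ltW.
have r1 : 0 < 1 + rho by rewrite addr_gt0.
have q1 : rho / (1 + rho) <= 1 by rewrite ler_pdivrMr // mul1r lerDr.
have q0 : 0 <= rho / (1 + rho) by rewrite divr_ge0 // ltW.
have hb' : b' <= rho / (1 + rho) * a by lra.
split => //.
have hb : b <= rho / (1 + rho) * a'.
  have : rho / (1 + rho) * (a - a') <= fnorm (A' - A).
    apply: (@le_trans _ _ (rho / (1 + rho) * fnorm (A' - A))).
      by rewrite ler_wpM2l.
    by rewrite ler_piMl ?fnorm_ge0.
  lra.
have := truncation_lipschitz h h' hb hb'.
have -> : 1 - rho / (1 + rho) = (1 + rho)^-1 by field; rewrite gt_eqF.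
by rewrite ler_pdivrMl.
Qed.

(** The new error is the linear step bounded by [beta], plus the linearization errors of [Y] and
    [A], plus the remainder of [truncation_expansion]. *)
Lemma error_step l m r (A A' Z Z' Y Y' F U : 'M[R]_(l, m)) W W' a b a' b' x h beta :
  truncation r A Z W a b -> truncation r A' Z' W' a' b' ->
  b < a -> 0 < x <= 1 -> 0 < h ->
  `|a - a'| <= fnorm (A - A') -> `|b - b'| <= fnorm (A - A') ->
  fnorm (A' - A - h *: F) <= x * h -> fnorm (Y' - Y - h *: U) <= x * h ->
  h * (fnorm F + 1) <= a / 2 -> h * (fnorm F + 1) <= gap_slack a b x ->
  fnorm (Y - Z + h *: (U - (F - normal_part Z W F))) <= beta ->
  forall rho, rho = b / (a - b) + x ->
  fnorm (Y' - Z') <= beta + h * (b / (a - b) * fnorm F +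
    x * (fnorm F + b / (a - b) + 3)
    + h * (3 / a * ((1 + rho) * (fnorm F + 1)) ^+ 2)).
Proof.
move=> tA tA' ba /andP[x0 x1] h0 aa bb AF YU ha hs hbeta rho rhoE.
have a0 := trunc_a tA; have a0' := trunc_a tA'; have pZ := trunc_pinv tA.
have F0 := fnorm_ge0 F.
have E1 : fnorm (A' - A) <= h * (fnorm F + x).
  rewrite -[A' - A](subrK (h *: F)); apply: le_trans (fnormD _ _) _.
  by rewrite fnormZ gtr0_norm // mulrDr addrC (mulrC h x) lerD2l.
have E2 : fnorm (A' - A) <= h * (fnorm F + 1).
  by apply: le_trans E1 _; rewrite ler_wpM2l ?(ltW h0) // lerD2l.
have [hb' hZ] := truncation_near tA tA' ba x0 aa bb (le_trans E2 hs) rhoE.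
have r0 : 0 < rho.
  by rewrite rhoE ltr_wpDl // divr_ge0 ?(trunc_b tA) // subr_ge0 ltW.
have r1 : 0 < 1 + rho by rewrite addr_gt0.
have aa' : a / 2 <= a'.
  by move: aa; rewrite ler_norml (fnormB A) => /andP[_ ?]; lra.
have ainv : a'^-1 <= 2 / a.
  by rewrite -[2 / a]invrK invf_div lef_pV2 ?posrE // divr_gt0.
have q1 : b' / a <= rho / (1 + rho) by rewrite ler_pdivrMr.
have q2 : b' / a <= 1.
  by apply: le_trans q1 _; rewrite ler_pdivrMr // mul1r lerDr.
have ex := truncation_expansion tA tA'.
set d := fnorm (Z' - Z) in hZ ex.
have d0 : 0 <= d := fnorm_ge0 _.
(* [rho / (1 + rho)] times the Lipschitz constant [1 + rho] is [rho], the source of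
   [b / (a - b)]. *)
have c1 : b' / a * d <= h * (rho * (fnorm F + x)).
  apply: (@le_trans _ _ (rho / (1 + rho) * ((1 + rho) * (h * (fnorm F + x))))).
    apply: ler_pM => //.
      by rewrite divr_ge0 ?(trunc_b tA') // ltW.
    by apply: le_trans hZ _; rewrite ler_wpM2l // ltW.
  by rewrite mulrA divfK ?gt_eqF // mulrCA.
(* [3 / a] is [2 / a] from [a' >= a / 2], plus [1 / a] from [b' <= a]. *)
have c2 : (a'^-1 + b' / a * a^-1) * d ^+ 2 <=
    h * (h * (3 / a * ((1 + rho) * (fnorm F + 1)) ^+ 2)).
  have -> : h * (h * (3 / a * ((1 + rho) * (fnorm F + 1)) ^+ 2)) =
     3 / a * ((1 + rho) * (h * (fnorm F + 1))) ^+ 2 by ring.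
  have inv0 : 0 <= a'^-1 by rewrite invr_ge0 ltW.
  have ai0 : 0 <= a^-1 by rewrite invr_ge0 ltW.
  apply: ler_pM; rewrite ?sqr_ge0 //.
  - by rewrite addr_ge0 // !mulr_ge0 // (trunc_b tA').
  - have -> : 3 / a = 2 / a + a^-1 by ring.
    by rewrite lerD // ler_piMl.
  - rewrite ler_pXn2r ?nnegrE //; last by rewrite !mulr_ge0 ?(ltW r1) ?(ltW h0) // addr_ge0.
    by apply: le_trans hZ _; rewrite ler_wpM2l // ltW.
have -> : Y' - Z' = (Y - Z + h *: (U - (F - normal_part Z W F))) +
  (Y' - Y - h *: U) - (Z' - Z - ((A' - A) - normal_part Z W (A' - A)))
  - ((A' - A - h *: F) - normal_part Z W (A' - A - h *: F)).
  rewrite (normal_partB Z W (A' - A)) normal_partZ.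
  move: (normal_part Z W (A' - A)) (normal_part Z W F) => N1 N2.
  by apply/matrixP => i j; rewrite !mxE; ring.
apply: le_trans (fnormD _ _) _; rewrite fnormN.
have t1 := le_trans (fnorm_tangent_part (A' - A - h *: F) pZ) AF.
apply: le_trans (lerD (fnormD _ _) t1) _; rewrite fnormN.
apply: le_trans (lerD (lerD (le_trans (fnormD _ _) (lerD hbeta YU)) ex) (lexx _)) _.
have xx : x * x <= x by rewrite ler_piMr // ltW.
have : h * (rho * (fnorm F + x)) <= h * (b / (a - b) * fnorm F +
    x * (fnorm F + b / (a - b) + 1)).
  by rewrite ler_wpM2l ?(ltW h0) // rhoE; lra.
by lra.
Qed.

End ErrorGrowth.

(** * Constant extension beyond an interval *)

Section Clamp.
Variable R : realType.

(** Retraction onto [[0, t]]: composing with it extends functions controlled on the interval to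
    continuous functions on the line. *)
Definition clamp (t s : R) : R := Num.max 0 (Num.min s t).

Lemma clamp_itv t s : 0 <= t -> clamp t s \in `[0, t].
Proof. by move=> t0; rewrite in_itv /= le_max lexx ge_max t0 ge_min lexx orbT. Qed.

Lemma clamp_id t s : s \in `[0, t] -> clamp t s = s.
Proof.
by rewrite in_itv /clamp /= => /andP[s0 /min_idPl ->]; exact/max_idPr.
Qed.

Lemma clamp_ge t s : 0 <= t -> t <= s -> clamp t s = t.
Proof. by move=> t0 ts; rewrite /clamp (min_idPr ts) (max_idPr t0). Qed.

Lemma clamp_lipschitz t u s : `|clamp t u - clamp t s| <= `|u - s|.
Proof.
have h1 := ler_norm (u - s); have h2 := ler_norm (- (u - s)); rewrite normrN in h2.
rewrite /clamp /Num.max /Num.min ler_norml.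
by do ?[case: ifPn => // /negbTE|case: ifPn => //]; rewrite -?leNgt; lra.
Qed.

Lemma continuous_clamp (t : R) (phi : R -> R) : 0 <= t ->
  (forall s, s \in `[0, t] -> forall e, 0 < e -> exists2 d, 0 < d &
    forall u, u \in `[0, t] -> `|u - s| < d -> `|phi u - phi s| <= e) ->
  continuous (fun s => phi (clamp t s)).
Proof.
move=> t0 hphi s; apply/cvgrPdist_le => e e0.
have [d d0 hd] := hphi _ (clamp_itv s t0) e e0.
apply/nbhs_ballP; exists d => // u; rewrite /ball /= => su; rewrite distrC.
apply: hd; first exact: clamp_itv.
by apply: le_lt_trans (clamp_lipschitz _ _ _) _; rewrite distrC.
Qed.

End Clamp.

(** * The error of the DO approximation *)

Section DOApproximation.
Variables (R : realType) (l m r : nat) (T K eta : R).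
Variables (L : R -> 'M[R]_(l, m) -> 'M[R]_(l, m)) (X Y : R -> 'M[R]_(l, m)).
Hypothesis r_gt0 : (0 < r)%N.
Hypothesis X_sol : solves_on `[0, T] L X.
Hypothesis rank_Y : forall t, t \in `[0, T] -> fixed_rank r (Y t).
Hypothesis Y_sol : solves_on `[0, T]
  (fun t A => orth_proj (tangent_space r A) (L t A)) Y.
Hypothesis Y_init : Y 0 = proj_fixed_rank r (X 0).
Hypothesis L_lip : forall t, t \in `[0, T] -> forall A B : 'M[R]_(l, m),
  fnorm (L t A - L t B) <= K * fnorm (A - B).
Hypothesis gap : forall t, t \in `[0, T] -> sigma r (X t) > sigma r.+1 (X t).
Hypothesis K_eta : forall t, t \in `[0, T] ->
  K + 2 / sigma r (X t) * fnorm (L t (X t)) <= eta.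

Let Z s := proj_fixed_rank r (X s).
Let a s := sigma r (X s).
Let b s := sigma r.+1 (X s).
Let n s := fnorm (X s - Z s).
Let f s := fnorm (L s (X s)).
Let err s := fnorm (Y s - Z s).
Let gam s := n s * (K + f s / (a s - b s)).

Let truncX s : s \in `[0, T] -> exists W, truncation r (X s) (Z s) W (a s) (b s).
Proof. by move=> sT; exact: proj_fixed_rank_truncation (gap sT). Qed.

(** Test the Lipschitz condition on [Z s] and [0]: [Z s] is nonzero, as its column projector has
    trace [r > 0]. *)
Let K_ge0 s : s \in `[0, T] -> 0 <= K.
Proof.
move=> sT; have [W /trunc_pinv[_ _ _ trW]] := truncX sT.
have Z0 : 0 < fnorm (Z s).
  rewrite lt_def fnorm_ge0 andbT; apply/eqP => /fnorm_eq0 Z0.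
  by move/eqP: trW; rewrite Z0 mul0mx mxtrace0 eq_sym pnatr_eq0 -leqn0 leqNgt r_gt0.
have := L_lip sT (Z s) 0; rewrite subr0 => h.
by rewrite -(pmulr_lge0 _ Z0); exact: le_trans (fnorm_ge0 _) h.
Qed.

Let fnorm_cont (g : R -> 'M[R]_(l, m)) (v : 'M[R]_(l, m)) s :
  has_derivative_within `[0, T] g s v ->
  forall e, 0 < e -> exists2 d, 0 < d & forall u, u \in `[0, T] -> `|u - s| < d ->
    fnorm (g u - g s) <= e.
Proof.
move=> dg e e0; have [d d0 hd] := has_derivative_within_fnorm dg ltr01.
have c0 : 0 < fnorm v + 1 by rewrite ltr_wpDl ?fnorm_ge0.
exists (Num.min d (e / (fnorm v + 1))); first by rewrite lt_min d0 divr_gt0.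
move=> u uT; rewrite lt_min => /andP[ud ue].
rewrite ltr_pdivlMr // in ue; apply: le_trans (ltW ue).
rewrite -[g u - g s](subrK ((u - s) *: v)); apply: le_trans (fnormD _ _) _.
by rewrite fnormZ mulrDr mulr1 addrC lerD2l -[leRHS]mul1r; exact: hd.
Qed.

Let X_cont s : s \in `[0, T] -> forall e, 0 < e -> exists2 d, 0 < d &
  forall u, u \in `[0, T] -> `|u - s| < d -> fnorm (X u - X s) <= e.
Proof. by move=> sT; apply: fnorm_cont (X_sol sT). Qed.

Let Y_cont s : s \in `[0, T] -> forall e, 0 < e -> exists2 d, 0 < d &
  forall u, u \in `[0, T] -> `|u - s| < d -> fnorm (Y u - Y s) <= e.
Proof.
by move=> sT; apply: fnorm_cont (Y_sol sT).
Qed.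

Let Z_cont s : s \in `[0, T] -> forall e, 0 < e -> exists2 d, 0 < d &
  forall u, u \in `[0, T] -> `|u - s| < d -> fnorm (Z u - Z s) <= e.
Proof.
move=> sT e e0; have [W tW] := truncX sT.
have sl0 := gap_slack_gt0 (trunc_b tW) (gap sT) ltr01.
pose rho := b s / (a s - b s) + 1.
have r0 : 0 < 1 + rho.
  by rewrite addr_gt0 // ltr_wpDl // divr_ge0 ?(trunc_b tW) // subr_ge0 ltW // gap.
have [|d d0 hd] := X_cont sT (e := Num.min (gap_slack (a s) (b s) 1) (e / (1 + rho))).
  by rewrite lt_min sl0 divr_gt0.
exists d => // u uT us; have := hd u uT us; rewrite le_min => /andP[h1 h2].
have [V tV] := truncX uT.
have [||_ hZ] := truncation_near tW tV (gap sT) ltr01 _ _ h1 (erefl rho).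
- exact: sigma_lipschitz (gap sT) (gap uT).
- exact: sigma_lipschitz (gap sT) (gap uT).
by apply: le_trans hZ _; rewrite mulrC -ler_pdivlMr.
Qed.

(** [error_step] fed with [fnorm_velocity_le]; then [b s <= n s] brings in the best approximation
    error, and [K_eta] collects the terms in [err s] into [eta]. *)
Let err_dini s e : 0 < e -> s \in `[0, T] -> exists2 d, 0 < d &
  forall h, 0 < h -> h < d -> s + h <= T ->
    err (s + h) <= err s + h * (eta * err s + gam s + e).
Proof.
move=> e0 sT; have [W tW] := truncX sT; have K0 := K_ge0 sT.
have s0 : 0 <= s by move: sT; rewrite in_itv => /andP[].
have a0 := trunc_a tW; have ab : 0 < a s - b s by rewrite subr_gt0 gap.
have f0 : 0 <= f s := fnorm_ge0 _.
have ba0 : 0 <= b s / (a s - b s) by rewrite divr_ge0 ?(trunc_b tW) // ltW.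
have err0 : 0 <= err s := fnorm_ge0 _.
pose U := orth_proj (tangent_space r (Y s)) (L s (Y s)).
pose V := L s (X s) - normal_part (Z s) W (L s (X s)).
pose k := f s + b s / (a s - b s) + 3.
have k0 : 0 < k by rewrite /k; lra.
(* Half of [e] pays for the linearization errors through [x], the other half for the terms in
   [h ^+ 2] through [d5]. *)
pose x := Num.min 1 (e / 2 / k).
have x0 : 0 < x by rewrite lt_min ltr01 !divr_gt0.
have x1 : x <= 1 by rewrite ge_min lexx.
have xk : x * k <= e / 2 by rewrite -ler_pdivlMr // ge_min lexx orbT.
pose rho := b s / (a s - b s) + x.
pose c := fnorm (U - V) ^+ 2 / (2 * err s).
pose c' := 3 / a s * ((1 + rho) * (f s + 1)) ^+ 2.
have c_ge0 : 0 <= c by rewrite divr_ge0 ?sqr_ge0 // mulr_ge0.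
have c'_ge0 : 0 <= c' by rewrite mulr_ge0 ?sqr_ge0 // divr_ge0 // ltW.
have [d1 d10 hd1] := has_derivative_within_fnorm (X_sol sT) x0.
have [d2 d20 hd2] := has_derivative_within_fnorm (Y_sol sT) x0.
have sl0 := gap_slack_gt0 (trunc_b tW) (gap sT) x0.
pose d3 := a s / 2 / (f s + 1); pose d4 := gap_slack (a s) (b s) x / (f s + 1).
pose d5 := e / 2 / (c + c' + 1).
have f1 : 0 < f s + 1 by rewrite ltr_wpDl.
have cc1 : 0 < c + c' + 1 by rewrite ltr_wpDl // addr_ge0.
exists (Num.min d1 (Num.min d2 (Num.min d3 (Num.min d4 d5)))).
  by rewrite !lt_min d10 d20 !divr_gt0.
move=> h h0; rewrite !lt_min => /and5P[h1 h2 h3 h4 h5] shT.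
have uT : s + h \in `[0, T] by rewrite in_itv /= shT addr_ge0 // ltW.
have hE : s + h - s = h by rewrite addrC addKr.
have hn : `|h| = h by rewrite gtr0_norm.
have b1 := hd1 _ uT; have b2 := hd2 _ uT.
rewrite hE hn in b1 b2; have {}b1 := b1 h1; have {}b2 := b2 h2.
have {}h3 : h * (f s + 1) <= a s / 2 by rewrite -ler_pdivlMr // ltW.
have {}h4 : h * (f s + 1) <= gap_slack (a s) (b s) x by rewrite -ler_pdivlMr // ltW.
have {}h5 : h * (c + c' + 1) <= e / 2 by rewrite -ler_pdivlMr // ltW.
have [W' tW'] := truncX uT.
have sl k' : `|sigma k' (X s) - sigma k' (X (s + h))| <= fnorm (X s - X (s + h)).
  exact: sigma_lipschitz (gap sT) (gap uT).
have vel := fnorm_velocity_le tW (rank_Y sT) K0 (ltW h0) (L_lip sT (Y s) (X s))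
  (erefl U) (erefl V).
have x01 : 0 < x <= 1 by rewrite x0.
have := error_step tW tW' (gap sT) x01 h0 (sl _) (sl _) b1 b2 h3 h4 vel (erefl rho).
rewrite -/(err (s + h)) -/(err s) -/(f s) -/(n s) -/k -/c -/c' => step.
apply: le_trans step _.
have z1 : 2 / a s * f s * err s <= (eta - K) * err s.
  by rewrite ler_wpM2r //; have := K_eta sT; rewrite -/(f s) -/(a s); lra.
have z2 : b s / (a s - b s) * f s <= n s * (f s / (a s - b s)).
  rewrite mulrAC mulrA ler_wpM2r ?invr_ge0 ?(ltW ab) // ler_wpM2r //.
  exact: (trunc_b_le tW).
have z3 : h * c + h * c' <= e / 2 by rewrite mulrDr mulr1 mulrDr in h5; lra.
have -> : h ^+ 2 * c = h * (h * c) by ring.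
rewrite -!addrA lerD2l -!mulrDr ler_wpM2l ?(ltW h0) // /gam; lra.
Qed.

Section UpTo.
Variable t : R.
Hypotheses (t_gt0 : 0 < t) (tT : t <= T).

Let sub s : s \in `[0, t] -> s \in `[0, T].
Proof. by rewrite !in_itv /= => /andP[-> /le_trans ->]. Qed.

Let t0 : 0 <= t. Proof. exact: ltW. Qed.

Let t_itv : t \in `[0, T]. Proof. by rewrite in_itv /= t0. Qed.

Let K0 : 0 <= K. Proof. exact: K_ge0 t_itv. Qed.

Let eta0 : 0 <= eta.
Proof.
apply: le_trans K0 _; have := K_eta t_itv; have [W tW] := truncX t_itv.
have : 0 <= 2 / sigma r (X t) * fnorm (L t (X t)).
  by rewrite mulr_ge0 ?fnorm_ge0 // divr_ge0 // ltW // (trunc_a tW).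
lra.
Qed.

Let sigma_cont k : continuous (fun s => sigma k (X (clamp t s))).
Proof.
apply: (continuous_clamp (phi := fun s => sigma k (X s))) => // s st e e0.
have [d d0 hd] := X_cont (sub st) e0; exists d => // u ut us.
apply: le_trans (hd u (sub ut) us); apply: sigma_lipschitz; exact/gap/sub.
Qed.

Let fnormB_cont (g g' : R -> 'M[R]_(l, m)) :
  (forall s, s \in `[0, T] -> forall e, 0 < e -> exists2 d, 0 < d &
    forall u, u \in `[0, T] -> `|u - s| < d -> fnorm (g u - g s) <= e) ->
  (forall s, s \in `[0, T] -> forall e, 0 < e -> exists2 d, 0 < d &
    forall u, u \in `[0, T] -> `|u - s| < d -> fnorm (g' u - g' s) <= e) ->
  continuous (fun s => fnorm (g (clamp t s) - g' (clamp t s))).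
Proof.
move=> cg cg'.
apply: (continuous_clamp (phi := fun s => fnorm (g s - g' s))) => // s st e e0.
have e2 : 0 < e / 2 by rewrite divr_gt0.
have [d d0 hd] := cg s (sub st) _ e2; have [d' d'0 hd'] := cg' s (sub st) _ e2.
exists (Num.min d d'); first by rewrite lt_min d0.
move=> u ut; rewrite lt_min => /andP[h1 h2].
apply: le_trans (ler_fnormB _ _) _.
have -> : g u - g' u - (g s - g' s) = (g u - g s) - (g' u - g' s).
  by apply/matrixP => i j; rewrite !mxE; ring.
apply: le_trans (fnormD _ _) _; rewrite fnormN.
have := hd u (sub ut) h1; have := hd' u (sub ut) h2; lra.
Qed.

Let diff_cont c : continuous (fun s => fnorm (X (clamp t (s + c)) - X (clamp t s))).
Proof.
move=> s; apply/cvgrPdist_le => e e0.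
have e2 : 0 < e / 2 by rewrite divr_gt0.
have [d d0 hd] := X_cont (sub (clamp_itv (s + c) t0)) e2.
have [d' d'0 hd'] := X_cont (sub (clamp_itv s t0)) e2.
apply/nbhs_ballP; exists (Num.min d d'); first by rewrite /= lt_min d0.
move=> u; rewrite /ball /= lt_min distrC => /andP[h1 h2].
rewrite distrC; apply: le_trans (ler_fnormB _ _) _.
set A1 := X (clamp t (u + c)); set A2 := X (clamp t u).
set B1 := X (clamp t (s + c)); set B2 := X (clamp t s).
have -> : A1 - A2 - (B1 - B2) = (A1 - B1) - (A2 - B2).
  by apply/matrixP => i j; rewrite !mxE; ring.
apply: le_trans (fnormD _ _) _; rewrite fnormN.
have k1 : fnorm (A1 - B1) <= e / 2.
  apply: hd; first exact/sub/clamp_itv.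
  apply: le_lt_trans (clamp_lipschitz _ _ _) _.
  by rewrite (_ : u + c - (s + c) = u - s) //; ring.
have k2 : fnorm (A2 - B2) <= e / 2.
  apply: hd'; first exact/sub/clamp_itv.
  exact: le_lt_trans (clamp_lipschitz _ _ _) _.
lra.
Qed.

Let exp_cont : continuous (fun s => expR (- eta * s)).
Proof.
move=> s; apply: (@continuous_comp _ _ _ (fun s => - eta * s) expR).
  by apply: cvgM; [exact: cvg_cst|exact: cvg_id].
exact: continuous_expR.
Qed.

(** [f] is the pointwise limit of the norms of forward difference quotients of [X], continuous in
    time; excluding [t] leaves room to the right. *)
Let f_measurable : measurable_fun `[0, t[ f.
Proof.
pose q k s := k.+1%:R * fnorm (X (clamp t (s + k.+1%:R^-1)) - X (clamp t s)).
apply: (@measurable_fun_cvg _ _ _ _ q) => [k|s].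
  apply: (@measurable_funS _ _ _ _ setT) => //.
  apply: continuous_measurable_fun => s.
  by apply: cvgM; [exact: cvg_cst|exact: diff_cont].
rewrite /= in_itv /= => /andP[s0 st].
have sT : s \in `[0, T] by apply: sub; rewrite in_itv /= s0 ltW.
apply/cvgrPdist_le => e e0.
have [d d0 hd] := has_derivative_within_fnorm (X_sol sT) e0.
have : \forall k \near \oo, k.+1%:R^-1 < Num.min d (t - s).
  have c0 : 0 < Num.min d (t - s) by rewrite lt_min d0 subr_gt0.
  have /cvgrPdist_lt/(_ _ c0) := @cvg_harmonic R; apply: filterS => k.
  by rewrite sub0r normrN ger0_norm // invr_ge0.
apply: filterS => k; rewrite lt_min /q; set h := k.+1%:R^-1 => /andP[kd kt].
have h0 : 0 < h by rewrite invr_gt0.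
rewrite !clamp_id; [|by rewrite in_itv /=; apply/andP; split; lra..].
have uT : s + h \in `[0, T].
  by have t_le := tT; rewrite in_itv /=; apply/andP; split; lra.
have := hd _ uT; rewrite (_ : s + h - s = h); last by rewrite addrC addKr.
rewrite (gtr0_norm h0) => /(_ kd) hX.
have := le_trans (ler_fnormB _ _) hX; rewrite fnormZ (gtr0_norm h0) -/(f s).
rewrite distrC -(invrK k.+1%:R) -/h => hf.
have -> : f s - h^-1 * fnorm (X (s + h) - X s) =
    h^-1 * (h * f s - fnorm (X (s + h) - X s)) by field; rewrite gt_eqF.
by rewrite normrM gtr0_norm ?invr_gt0 // ler_pdivrMl // (mulrC h e).
Qed.

Let gap_clamp s : 0 < a (clamp t s) - b (clamp t s).
Proof. by rewrite subr_gt0; apply/gap/sub/clamp_itv. Qed.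

Let g s := expR (- eta * s) * gam s.

Let g_measurable : measurable_fun `[0, t] g.
Proof.
rewrite -(@setUitv1 _ _ (BLeft 0) t true) ?bnd_simp //.
apply/measurable_funU; [exact: measurable_itv|exact: measurable_set1|split].
  apply: (@eq_measurable_fun _ _ _ _ _ (fun s => expR (- eta * s) *
    (fnorm (X (clamp t s) - Z (clamp t s)) *
     (K + f s * (a (clamp t s) - b (clamp t s))^-1)))).
    move=> s; rewrite inE /= in_itv /= => /andP[s0 st].
    by rewrite /g /gam clamp_id // in_itv /= s0 ltW.
  have cm (h : R -> R) : continuous h -> measurable_fun `[0, t[ h.
    by move=> ch; apply: (@measurable_funS _ _ _ _ setT) => //; exact: continuous_measurable_fun.
  apply: measurable_funM; first exact: cm.
  apply: measurable_funM; first by apply: cm; exact: fnormB_cont.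
  apply: measurable_funD; first exact: measurable_cst.
  apply: measurable_funM => //; apply: cm => s; apply: cvgV; first by rewrite gt_eqF.
  by apply: cvgB; exact: sigma_cont.
exact: measurable_fun_set1.
Qed.

Let expN_le1 s : 0 <= s -> expR (- eta * s) <= 1.
Proof. by move=> s0; rewrite -[leRHS]expR0 ler_expR mulNr oppr_le0 mulr_ge0. Qed.

Let gam_ge0 s : s \in `[0, t] -> 0 <= gam s.
Proof.
move=> st; rewrite mulr_ge0 ?fnorm_ge0 // addr_ge0 // divr_ge0 ?fnorm_ge0 //.
by rewrite subr_ge0 ltW // gap // sub.
Qed.

(** [f] may be discontinuous, but [K_eta] bounds it by [(eta - K) / 2 * sigma_r]. This yields the
    continuous majorant [B], which attains a maximum. *)
Let g_bounded : exists C, forall s, s \in `[0, t] -> 0 <= g s <= C.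
Proof.
pose B s := fnorm (X (clamp t s) - Z (clamp t s)) *
  (K + (eta - K) / 2 * (a (clamp t s) / (a (clamp t s) - b (clamp t s)))).
have cB : continuous B.
  move=> s; apply: cvgM; first exact: fnormB_cont.
  apply: cvgD; first exact: cvg_cst.
  apply: cvgM; first exact: cvg_cst.
  apply: cvgM; first exact: sigma_cont.
  apply: cvgV; first by rewrite gt_eqF.
  by apply: cvgB; exact: sigma_cont.
have [c _ hc] := EVT_max t0 (continuous_subspaceT cB).
exists (B c) => s st; rewrite mulr_ge0 ?expR_ge0 ?gam_ge0 //=.
apply: le_trans (hc s st); rewrite /B clamp_id //.
have s0 : 0 <= s by move: st; rewrite in_itv => /andP[].
apply: (@le_trans _ _ (gam s)); first by rewrite ler_piMl ?gam_ge0 ?expN_le1.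
rewrite /gam -/(n s) ler_wpM2l ?fnorm_ge0 // lerD2l mulrA ler_wpM2r //.
  by rewrite invr_ge0 subr_ge0 ltW // gap // sub.
have [W tW] := truncX (sub st); have as0 := trunc_a tW.
have := K_eta (sub st); rewrite -/(a s) -/(f s) => h.
have -> : f s = 2 / a s * f s / 2 * a s by field; rewrite gt_eqF.
by rewrite ler_wpM2r ?(ltW as0) // ler_wpM2r // ; lra.
Qed.

(** The weight [exp(- eta s)] absorbs the term [eta * err s] of [err_dini], so the weighted error
    has Dini derivative at most [g]. Multiplying the integrated bound by [exp(eta t)] restores the
    kernel. *)
Lemma DO_error_integral : err t <=
  \int[lebesgue_measure]_(s in `[0, t]) (gam s * expR (eta * (t - s))).
Proof.
pose w s := expR (- eta * clamp t s) * err (clamp t s).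
have [C gC] := g_bounded.
have cw : continuous w.
  move=> s; apply: cvgM; last exact: fnormB_cont.
  apply: (@continuous_clamp _ t (fun s => expR (- eta * s)) t0) => u ut e e0.
  have /cvgrPdist_le/(_ _ e0)/nbhs_ballP[d /= d0 hd] := exp_cont (x := u).
  by exists d => // v vt uv; rewrite distrC; apply: hd; rewrite /ball /= distrC.
have wt s : t <= s -> w s = w t by move=> ts; rewrite /w !clamp_ge.
have dw s : 0 <= s < t -> dini_le w s (g s).
  move=> /andP[s0 st] e e0.
  have s_itv : s \in `[0, t] by rewrite in_itv /= s0 ltW.
  have [d d0 hd] := err_dini e0 (sub s_itv).
  exists (Num.min d (t - s)); first by rewrite lt_min d0 subr_gt0.
  move=> h h0; rewrite lt_min => /andP[h_d hts].
  rewrite /w !clamp_id //; last by rewrite in_itv /=; apply/andP; split; lra.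
  have := hd h h0 h_d; have -> : s + h <= T by have t_le := tT; lra.
  move=> /(_ isT) step.
  have es : 0 <= expR (- eta * s) := expR_ge0 _.
  have eh : 0 <= expR (- eta * h) := expR_ge0 _.
  rewrite mulrDr expRD -mulrA /g.
  apply: (@le_trans _ _ (expR (- eta * s) * (err s + h * (gam s + e)))); last first.
    rewrite mulrDr lerD2l mulrCA ler_wpM2l ?(ltW h0) // mulrDr lerD2l.
    by rewrite ler_piMl ?(ltW e0) ?expN_le1.
  rewrite ler_wpM2l //.
  apply: (le_trans (ler_wpM2l eh step)).
  (* The growth term disappears because [(1 + eta h) exp(- eta h) <= 1]. *)
  have -> : err s + h * (eta * err s + gam s + e) =
    (1 + eta * h) * err s + h * (gam s + e) by ring.
  rewrite mulrDr lerD //.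
    rewrite mulrA ler_piMl ?fnorm_ge0 //.
    by rewrite mulNr expRN mulrC ler_pdivrMr ?expR_gt0 // mul1r expR_ge1Dx.
  by rewrite ler_piMl ?expN_le1 ?(ltW h0) // mulr_ge0 ?(ltW h0) // addr_ge0 ?gam_ge0 // ltW.
have := dini_le_integral cw t_gt0 wt g_measurable gC dw.
have t_in : t \in `[0, t] by rewrite in_itv /= t0 lexx.
have z_in : 0 \in `[0, t] by rewrite in_itv /= t0 lexx.
rewrite /w !clamp_id // /err Y_init subrr fnorm0 mulr0 subr0 -/(err t) => key.
have ig : lebesgue_measure.-integrable `[0, t] (EFin \o g).
  apply: (integrable_bounded_itv (C := C)) => // s st.
  by have /andP[g0 ?] := gC s st; rewrite ger0_norm.
have -> : \int[lebesgue_measure]_(s in `[0, t]) (gam s * expR (eta * (t - s))) =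
    \int[lebesgue_measure]_(s in `[0, t]) (expR (eta * t) * g s).
  apply: eq_Rintegral => s _; rewrite /g mulrBr expRD mulNr.
  by rewrite mulrC -mulrA.
rewrite RintegralZl //; apply: le_trans (ler_wpM2l (expR_ge0 _) key).
by rewrite mulrA -expRD mulNr addrN expR0 mul1r.
Qed.

End UpTo.

End DOApproximation.

Theorem theorem5p6 (R : realType) (l m r : nat) (T K eta : R)
    (L : R -> 'M[R]_(l, m) -> 'M[R]_(l, m))
    (X Y : R -> 'M[R]_(l, m))
    (hr : (0 < r)%N) (hT : 0 <= T)
    (hX : solves_on `[0, T] L X)
    (hYM : forall t, t \in `[0, T] -> fixed_rank r (Y t))
    (hY : solves_on `[0, T]
            (fun t A => orth_proj (tangent_space r A) (L t A)) Y)
    (hY0 : Y 0 = proj_fixed_rank r (X 0))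
    (hLip : forall t, t \in `[0, T] -> forall A B : 'M[R]_(l, m),
            fnorm (L t A - L t B) <= K * fnorm (A - B))
    (hgap : forall t, t \in `[0, T] -> sigma r (X t) > sigma r.+1 (X t))
    (heta : eta%:E =
            (K%:E + ereal_sup [set (2 / sigma r (X t) * fnorm (L t (X t)))%:E
                              | t in `[0%R, T]])%E) :
  forall t, t \in `[0, T] ->
    fnorm (Y t - proj_fixed_rank r (X t)) <=
    \int[lebesgue_measure]_(s in `[0, t])
      (fnorm (X s - proj_fixed_rank r (X s)) *
       (K + fnorm (L s (X s)) / (sigma r (X s) - sigma r.+1 (X s))) *
       expR (eta * (t - s))).
Proof.
(* The supremum lives in the extended reals and dominates each member; its sum with [K] is the real
   number [eta]. *)
have K_eta t : t \in `[0, T] -> K + 2 / sigma r (X t) * fnorm (L t (X t)) <= eta.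
  move=> tT; rewrite -lee_fin heta EFinD leeD2l //.
  by apply: ereal_sup_ubound; exists t.
move=> t tT; have [t0 t_le] : 0 <= t /\ t <= T by move: (tT); rewrite in_itv => /andP.
have [t_gt0|] := ltP 0 t.
  exact: (DO_error_integral hr hX hYM hY hY0 hLip hgap K_eta t_gt0 t_le).
(* At [t = 0] both sides vanish, the left one by the initial condition. *)
move=> t_le0; have -> : t = 0 by apply/le_anti; rewrite t_le0.
rewrite hY0 subrr fnorm0 set_itv1 Rintegral_set1.
exact: lexx.
Qed.
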